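(* Let $n\in\omega\setminus\{0\}$. Define the multi-sorted alter ego $$\mathbb M_n=\langle M_0\,\dot\cup\,M_1\,\dot\cup\cdots\dot\cup\,M_n;\ \mathcal G_{(n)},\mathcal S_{(n)},\mathscr T\rangle,$$ where $\mathcal G_{(n)}=\{g_k\mid k\in\{1,\dots,n\}\}$ and $$\mathcal S_{(n)}=\{\leqslant^k\ \mid k\in\{0,\dots,n\}\}\cup\{\leqslant^{jk}\ \mid j,k\in\{1,\dots,n\}\text{ with }j<k\}.$$ Then: (1) $\mathbb M_n$ yields a strong, and therefore full, duality on the variety $\mathcal V_n=\mathsf{HSP}(\mathbf J_n)=\mathsf{ISP}(\{\mathbf M_0,\mathbf M_1,\dots,\mathbf M_n\})$. (2) $|\mathcal S_{(n)}\cup\mathcal G_{(n)}|=\tfrac12(n^2+3n+2)$.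
   Context: **The algebra $\mathbf J_n$** ($n\in\omega$). $J_n=\{\top,\bot,f_0,\dots,f_n,t_0,\dots,t_n\}$ ($2n+4$ distinct elements). Knowledge order $\leqslant_k$: $\bot$ is least, $\top$ is greatest, $f_n<_k\cdots<_k f_0$, $t_n<_k\cdots<_k t_0$, each $f_i$ incomparable to each $t_j$. Truth order $\leqslant_t$: $f_0<_t\cdots<_t f_n<_t x<_t t_n<_t\cdots<_t t_0$ for both $x\in\{\top,\bot\}$, with $\top,\bot$ incomparable. $\otimes,\oplus$ are meet and join for $\leqslant_k$, $\wedge,\vee$ are meet and join for $\leqslant_t$; $\neg\top=\top$, $\neg\bot=\bot$, $\neg f_m=t_m$, $\neg t_m=f_m$. $\mathbf J_n=\langle J_n;\otimes,\oplus,\wedge,\vee,\neg,\top,f_0,\dots,f_n,t_0,\dots,t_n,\bot\rangle$, every element being named by a constant. **The algebras $\mathbf M_k$** (in the signature of $\mathbf J_n$). $\mathbf M_0$ has universe $\{\top,f,t,\bot\}$; its operations $\otimes,\oplus,\wedge,\vee,\neg$ and constants $\top,\bot$ are those of $\mathbf J_0$ with $f_0,t_0$ renamed $f,t$; all constants $f_0,\dots,f_n$ take the value $f$ and all constants $t_0,\dots,t_n$ take the value $t$. For $k\in\{1,\dots,n\}$, $\mathbf M_k$ has universe $\{\top,\mathbf 0,f,\mathbf 1,t,\bot\}$; its operations $\otimes,\oplus,\wedge,\vee,\neg$ and constants $\top,\bot$ are those of $\mathbf J_1$ with $f_0,f_1,t_0,t_1$ renamed $\mathbf 0,f,\mathbf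 1,t$ respectively; the constants $f_0,\dots,f_{k-1}$ take the value $\mathbf 0$, $f_k,\dots,f_n$ the value $f$, $t_0,\dots,t_{k-1}$ the value $\mathbf 1$, and $t_k,\dots,t_n$ the value $t$. The sorts $M_0,\dots,M_n$ are regarded as disjoint. **Relations and maps.** - $\leqslant^0=(M_0\times\{\top\})\cup(\{\bot\}\times M_0)\cup\{(f,f),(t,t)\}$ on $M_0$. - For $k\in\{1,\dots,n\}$, $\leqslant^k=\{(\top,\top),(\bot,\bot),(f,f),(f,\mathbf 0),(\mathbf 0,\mathbf 0),(t,t),(t,\mathbf 1),(\mathbf 1,\mathbf 1)\}$ on $M_k$. - For $1\leqslant j<k\leqslant n$, $\leqslant^{jk}$ is the same set of pairs, regarded as a relation from $M_j$ to $M_k$ (a subset of $M_j\times M_k$). - $g_k:\mathbf M_k\to\mathbf M_0$ is the homomorphism with $f,\mathbf 0\mapsto f$; $t,\mathbf 1\mapsto t$; $\top\mapsto\top$; $\bot\mapsto\bot$. **Multi-sorted dualities.** Let $\mathcal A=\mathsf{ISP}(\{\mathbf M_0,\dots,\mathbf M_n\})$ (isomorphic copies of subalgebras of products, the empty product allowed). Let $\mathbb M=\langle M_0\dot\cup\cdots\dot\cup M_n;\mathcal G,\mathcal R,\mathscr T\rangle$, where each $g\in\mathcal G$ is a homomorphism $\mathbf M_j\to\mathbf M_k$ for some $j,k$, each $R\in\mathcal R$ is a non-empty subuniverse of some $\mathbf M_j\times\mathbf M_k$, and $\mathscr T$ is discrete. For a non-empty set $I$, $\mathbb M^I$ has sorts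 $M_0^I,\dots,M_n^I$ with the product topologies and with operations and relations defined pointwise. $\mathcal X=\mathsf{IS_cP^+}(\mathbb M)$ is the category of isomorphic copies of topologically closed (multi-sorted) substructures of powers $\mathbb M^I$, $I\ne\varnothing$ (sorts may be empty); morphisms are continuous sort-preserving maps preserving the operations and relations. $\mathrm D(\mathbf A)=\mathcal A(\mathbf A,\mathbf M_0)\,\dot\cup\cdots\dot\cup\,\mathcal A(\mathbf A,\mathbf M_n)$ as a closed substructure of $\mathbb M^A$, and $\mathrm E(\mathbb X)=\mathcal X(\mathbb X,\mathbb M)$ as a subalgebra of $\mathbf M_0^{X_0}\times\cdots\times\mathbf M_n^{X_n}$. Evaluation maps: $e_{\mathbf A}:\mathbf A\to\mathrm{ED}(\mathbf A)$, $e_{\mathbf A}(a)(x)=x(a)$; $\varepsilon_{\mathbb X}:\mathbb X\to\mathrm{DE}(\mathbb X)$, $\varepsilon_{\mathbb X}(x)(\alpha)=\alpha(x)$. $\mathbb M$ *yields a duality* on $\mathcal A$ if every $e_{\mathbf A}$ ($\mathbf A\in\mathcal A$) is an isomorphism; a *full duality* if also every $\varepsilon_{\mathbb X}$ ($\mathbb X\in\mathcal X$) is an isomorphism; a *strong duality* if it yields a full duality and $\mathbb M$ is injective in $\mathcal X$ (morphisms into $\mathbb M$ extend along embeddings in $\mathcal X$). *)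

(* Defs.v *)
From HB Require Import structures.
From mathcomp Require Import all_boot all_order all_algebra.
From mathcomp Require Import all_classical topology.

Set Implicit Arguments.
Unset Strict Implicit.
Unset Printing Implicit Defensive.

Local Open Scope classical_set_scope.

Record alg (n : nat) := Alg {
  car :> Type;
  otimes : car -> car -> car;
  oplus : car -> car -> car;
  wedge : car -> car -> car;
  vee : car -> car -> car;
  neg : car -> car;
  ctop : car;
  cbot : car;
  cf : 'I_n.+1 -> car;
  ct : 'I_n.+1 -> car }.

Record is_hom (n : nat) (A B : alg n) (h : A -> B) : Prop := IsHom {
  hom_otimes : forall x y, h (otimes x y) = otimes (h x) (h y);
  hom_oplus : forall x y, h (oplus x y) = oplus (h x) (h y);
  hom_wedge : forall x y, h (wedge x y) = wedge (h x) (h y);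
  hom_vee : forall x y, h (vee x y) = vee (h x) (h y);
  hom_neg : forall x, h (neg x) = neg (h x);
  hom_ctop : h (ctop A) = ctop B;
  hom_cbot : h (cbot A) = cbot B;
  hom_cf : forall i, h (cf A i) = cf B i;
  hom_ct : forall i, h (ct A i) = ct B i }.

Definition is_alg_iso (n : nat) (A B : alg n) (h : A -> B) : Prop :=
  is_hom h /\ bijective h.

Record subuniverse (n : nat) (A : alg n) (U : set A) : Prop := Subuniverse {
  sub_otimes : forall x y, U x -> U y -> U (otimes x y);
  sub_oplus : forall x y, U x -> U y -> U (oplus x y);
  sub_wedge : forall x y, U x -> U y -> U (wedge x y);
  sub_vee : forall x y, U x -> U y -> U (vee x y);
  sub_neg : forall x, U x -> U (neg x);
  sub_ctop : U (ctop A);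
  sub_cbot : U (cbot A);
  sub_cf : forall i, U (cf A i);
  sub_ct : forall i, U (ct A i) }.

Definition subalg (n : nat) (A : alg n) (U : set A) (sU : subuniverse U) :
    alg n :=
  @Alg n {x : A | U x}
    (fun x y => exist _ _ (sub_otimes sU (proj2_sig x) (proj2_sig y)))
    (fun x y => exist _ _ (sub_oplus sU (proj2_sig x) (proj2_sig y)))
    (fun x y => exist _ _ (sub_wedge sU (proj2_sig x) (proj2_sig y)))
    (fun x y => exist _ _ (sub_vee sU (proj2_sig x) (proj2_sig y)))
    (fun x => exist _ _ (sub_neg sU (proj2_sig x)))
    (exist _ _ (sub_ctop sU))
    (exist _ _ (sub_cbot sU))
    (fun i => exist _ _ (sub_cf sU i))
    (fun i => exist _ _ (sub_ct sU i)).

Definition prod_alg (n : nat) (I : Type) (F : I -> alg n) : alg n :=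
  @Alg n (forall i, F i)
    (fun x y i => otimes (x i) (y i))
    (fun x y i => oplus (x i) (y i))
    (fun x y i => wedge (x i) (y i))
    (fun x y i => vee (x i) (y i))
    (fun x i => neg (x i))
    (fun i => ctop (F i))
    (fun i => cbot (F i))
    (fun c i => cf (F i) c)
    (fun c i => ct (F i) c).

Definition pair_alg (n : nat) (A B : alg n) : alg n :=
  @Alg n (A * B)%type
    (fun x y => (otimes x.1 y.1, otimes x.2 y.2))
    (fun x y => (oplus x.1 y.1, oplus x.2 y.2))
    (fun x y => (wedge x.1 y.1, wedge x.2 y.2))
    (fun x y => (vee x.1 y.1, vee x.2 y.2))
    (fun x => (neg x.1, neg x.2))
    (ctop A, ctop B)
    (cbot A, cbot B)
    (fun c => (cf A c, cf B c))
    (fun c => (ct A c, ct B c)).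

Definition classI (n : nat) (K : alg n -> Prop) (B : alg n) : Prop :=
  exists A : alg n, K A /\ exists h : A -> B, is_alg_iso h.

Definition classH (n : nat) (K : alg n -> Prop) (B : alg n) : Prop :=
  exists A : alg n, K A /\
    exists h : A -> B, is_hom h /\ (forall b, exists a, h a = b).

Definition classS (n : nat) (K : alg n -> Prop) (B : alg n) : Prop :=
  exists (A : alg n) (U : set A) (sU : subuniverse U), K A /\ B = subalg sU.

(* The index type may be empty, giving the one-element algebra. *)
Definition classP (n : nat) (K : alg n -> Prop) (B : alg n) : Prop :=
  exists (I : Type) (F : I -> alg n), (forall i, K (F i)) /\ B = prod_alg F.

Inductive J (n : nat) : Type :=
  | Top | Bot | F (i : 'I_n.+1) | T (i : 'I_n.+1).
Arguments Top {n}.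
Arguments Bot {n}.
Arguments F {n} i.
Arguments T {n} i.

Section JFinite.
Variable n : nat.

Definition J_to_sum (x : J n) : bool + ('I_n.+1 + 'I_n.+1) :=
  match x with
  | Top => inl true | Bot => inl false
  | F i => inr (inl i) | T i => inr (inr i)
  end.

Definition J_of_sum (x : bool + ('I_n.+1 + 'I_n.+1)) : J n :=
  match x with
  | inl true => Top | inl false => Bot
  | inr (inl i) => F i | inr (inr i) => T i
  end.

Lemma J_to_sumK : cancel J_to_sum J_of_sum. Proof. by case. Qed.

HB.instance Definition _ := Finite.copy (J n) (can_type J_to_sumK).
HB.instance Definition _ := hasNbhs.Build (J n) principal_filter.
HB.instance Definition _ := Discrete_ofNbhs.Build (J n) erefl.

End JFinite.

Section JOrders.
Variable n : nat.
Implicit Types x y z : J n.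

Definition leqk x y : bool :=
  match x, y with
  | Bot, _ | _, Top => true
  | F i, F j | T i, T j => (j <= i)%N
  | _, _ => false
  end.

Definition leqt x y : bool :=
  match x, y with
  | F i, F j => (i <= j)%N
  | T i, T j => (j <= i)%N
  | F _, _ | _, T _ => true
  | Top, Top | Bot, Bot => true
  | _, _ => false
  end.

(* The last branches are for the incomparable pairs: {f_i, t_j} for the
   knowledge order, {top, bottom} for the truth order.  The lemmas below say
   that these are the lattice operations of the two orders. *)
Definition kmeet x y := if leqk x y then x else if leqk y x then y else Bot.
Definition kjoin x y := if leqk x y then y else if leqk y x then x else Top.
Definition tmeet x y :=
  if leqt x y then x else if leqt y x then y else F ord_max.
Definition tjoin x y :=
  if leqt x y then y else if leqt y x then x else T ord_max.

Definition jneg x : J n :=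
  match x with Top => Top | Bot => Bot | F i => T i | T i => F i end.

Lemma leqk_refl : reflexive leqk.
Proof. by case=> //= i; rewrite leqnn. Qed.

Lemma leqt_refl : reflexive leqt.
Proof. by case=> //= i; rewrite leqnn. Qed.

Lemma leqk_anti : antisymmetric leqk.
Proof.
by move=> [||i|i] [||j|j] //= /andP[h1 h2]; do ?f_equal; apply: val_inj;
  apply/eqP; rewrite eqn_leq h1 h2.
Qed.

Lemma leqt_anti : antisymmetric leqt.
Proof.
by move=> [||i|i] [||j|j] //= /andP[h1 h2]; do ?f_equal; apply: val_inj;
  apply/eqP; rewrite eqn_leq h1 h2.
Qed.

Lemma leqk_trans : transitive leqk.
Proof.
by move=> [||j|j] [||i|i] [||k|k] //= h1 h2; apply: leq_trans h2 h1.
Qed.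

Lemma leqt_trans : transitive leqt.
Proof.
by move=> [||j|j] [||i|i] [||k|k] //= h1 h2;
  solve [apply: leq_trans h2 h1 | apply: leq_trans h1 h2].
Qed.

Lemma kmeetP x y z : leqk z (kmeet x y) = leqk z x && leqk z y.
Proof.
rewrite /kmeet; case xy: (leqk x y).
  by apply/idP/andP => [zx|[]//]; split=> //; apply: leqk_trans zx xy.
case yx: (leqk y x).
  by apply/idP/andP => [zy|[]//]; split=> //; apply: leqk_trans zy yx.
by move: x y z xy yx => [||i|i] [||j|j] [||k|k] //= xy yx;
  first [done | rewrite andbF | have := leq_total i j; rewrite xy yx].
Qed.

Lemma kjoinP x y z : leqk (kjoin x y) z = leqk x z && leqk y z.
Proof.
rewrite /kjoin; case xy: (leqk x y).
  by apply/idP/andP => [zx|[]//]; split=> //; apply: leqk_trans xy zx.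
case yx: (leqk y x).
  by apply/idP/andP => [zy|[]//]; split=> //; apply: leqk_trans yx zy.
by move: x y z xy yx => [||i|i] [||j|j] [||k|k] //= xy yx;
  first [done | rewrite andbF | have := leq_total i j; rewrite xy yx].
Qed.

Lemma tmeetP x y z : leqt z (tmeet x y) = leqt z x && leqt z y.
Proof.
rewrite /tmeet; case xy: (leqt x y).
  by apply/idP/andP => [zx|[]//]; split=> //; apply: leqt_trans zx xy.
case yx: (leqt y x).
  by apply/idP/andP => [zy|[]//]; split=> //; apply: leqt_trans zy yx.
move: x y z xy yx => [||i|i] [||j|j] [||k|k] //= xy yx;
  by first [done | have := leq_total i j; rewrite xy yx | rewrite leq_ord].
Qed.

Lemma tjoinP x y z : leqt (tjoin x y) z = leqt x z && leqt y z.
Proof.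
rewrite /tjoin; case xy: (leqt x y).
  by apply/idP/andP => [zx|[]//]; split=> //; apply: leqt_trans xy zx.
case yx: (leqt y x).
  by apply/idP/andP => [zy|[]//]; split=> //; apply: leqt_trans yx zy.
move: x y z xy yx => [||i|i] [||j|j] [||k|k] //= xy yx;
  by first [done | have := leq_total i j; rewrite xy yx | rewrite leq_ord].
Qed.

End JOrders.

Definition Jalg (n : nat) : alg n :=
  @Alg n (J n) (@kmeet n) (@kjoin n) (@tmeet n) (@tjoin n) (@jneg n)
    Top Bot F T.

(* The universe of M_0 is that of J_0 and, for k > 0, the universe of M_k is
   that of J_1 (the boolean 0 < k is read as a natural number).  Disjointness
   of the sorts is obtained by always carrying the index k along. *)
Definition M (n : nat) (k : 'I_n.+1) := J (0 < k)%N.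

(* fM and tM are f and t; for k > 0, zeroM and oneM are the elements written
   as boldface 0 and 1 (for k = 0 they coincide with fM and tM). *)
Definition fM (n : nat) (k : 'I_n.+1) : M k := F ord_max.
Definition tM (n : nat) (k : 'I_n.+1) : M k := T ord_max.
Definition zeroM (n : nat) (k : 'I_n.+1) : M k := F ord0.
Definition oneM (n : nat) (k : 'I_n.+1) : M k := T ord0.

Definition Malg (n : nat) (k : 'I_n.+1) : alg n :=
  @Alg n (M k) (@kmeet _) (@kjoin _) (@tmeet _) (@tjoin _) (@jneg _) Top Bot
    (fun i => if (i < k)%N then zeroM k else fM k)
    (fun i => if (i < k)%N then oneM k else tM k).

(* Operations M_j -> M_k and relations between M_j and M_k, tagged with the
   pair (j, k) because the sorts are disjoint. *)
Definition msop (n : nat) :=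
  {jk : 'I_n.+1 * 'I_n.+1 & {ffun M jk.1 -> M jk.2}}.
Definition msrel (n : nat) :=
  {jk : 'I_n.+1 * 'I_n.+1 & {set M jk.1 * M jk.2}}.


Definition src (n : nat) (g : msop n) : 'I_n.+1 := (tag g).1.
Definition tgt (n : nat) (g : msop n) : 'I_n.+1 := (tag g).2.
Definition app (n : nat) (g : msop n) (x : M (src g)) : M (tgt g) :=
  tagged g x.

Definition rsrc (n : nat) (r : msrel n) : 'I_n.+1 := (tag r).1.
Definition rtgt (n : nat) (r : msrel n) : 'I_n.+1 := (tag r).2.
Definition holds (n : nat) (r : msrel n) (x : M (rsrc r)) (y : M (rtgt r)) :
  Prop := (x, y) \in tagged r.

Record alter_ego (n : nat) := AlterEgo {
  aops : {set msop n};
  arels : {set msrel n};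
  aops_hom : forall g, g \in aops ->
    @is_hom n (Malg (src g)) (Malg (tgt g)) (@app n g);
  arels_sub : forall r, r \in arels ->
    @subuniverse n (pair_alg (Malg (rsrc r)) (Malg (rtgt r)))
      [set xy | holds xy.1 xy.2];
  arels_nonempty : forall r, r \in arels -> exists x y, @holds n r x y }.

Section Structures.
Variables (n : nat) (AE : alter_ego n).

Record mstruct := MStruct {
  sort :> 'I_n.+1 -> topologicalType;
  sop : forall g : msop n, g \in aops AE -> sort (src g) -> sort (tgt g);
  srel : forall r : msrel n, r \in arels AE ->
    sort (rsrc r) -> sort (rtgt r) -> Prop }.

Record is_mor (X Y : mstruct) (phi : forall k, X k -> Y k) : Prop := IsMor {
  mor_cont : forall k, continuous (phi k);
  mor_op : forall g (gG : g \in aops AE) (x : X (src g)),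
    phi _ (sop gG x) = sop gG (phi _ x);
  mor_rel : forall r (rR : r \in arels AE) (x : X (rsrc r)) (y : X (rtgt r)),
    srel rR x y -> srel rR (phi _ x) (phi _ y) }.

Definition is_iso (X Y : mstruct) (phi : forall k, X k -> Y k) : Prop :=
  is_mor phi /\ exists psi : forall k, Y k -> X k,
    [/\ is_mor psi, forall k, cancel (phi k) (psi k)
      & forall k, cancel (psi k) (phi k)].

(* The topology on each sort is the discrete one declared on J above. *)
Definition self : mstruct :=
  @MStruct (fun k => M k) (fun g _ => @app n g) (fun r _ => @holds n r).

(* {ptws I -> M k} is the power of M k with the product topology. *)
Definition power (I : Type) : mstruct :=
  @MStruct (fun k => {ptws I -> M k})
    (fun g _ x i => app (x i))
    (fun r _ x y => forall i, holds (x i) (y i)).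

Definition op_stable (X : mstruct) (Z : forall k, set (X k)) : Prop :=
  forall g (gG : g \in aops AE) (x : X (src g)),
    x \in Z _ -> sop gG x \in Z _.

(* set_type (Z k) carries the subspace topology. *)
Definition substruct (X : mstruct) (Z : forall k, set (X k))
    (sZ : op_stable Z) : mstruct :=
  @MStruct (fun k => set_type (Z k))
    (fun g gG x => exist _ (sop gG (val x)) (sZ g gG (val x) (valP x)))
    (fun r rR x y => srel rR (val x) (val y)).

(* phi is an isomorphism onto a topologically closed substructure of Y. *)
Definition is_embedding (X Y : mstruct) (phi : forall k, X k -> Y k) : Prop :=
  exists (Z : forall k, set (Y k)) (sZ : op_stable Z),
    (forall k, closed (Z k)) /\
    exists psi : forall k, X k -> substruct sZ k,
      is_iso psi /\ forall k x, phi k x = val (psi k x).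

Definition IScP (X : mstruct) : Prop :=
  exists I : Type, inhabited I /\
    exists phi : forall k, X k -> power I k, is_embedding phi.

Lemma D_op_stable (A : alg n) :
  @op_stable (power A) (fun k => [set x : A -> M k | is_hom (B := Malg k) x]).
Proof.
move=> g gG x; rewrite !in_setE /= => -[h1 h2 h3 h4 h5 h6 h7 h8 h9].
have [k1 k2 k3 k4 k5 k6 k7 k8 k9] := aops_hom gG.
by split=> [a b|a b|a b|a b|a|||i|i];
  rewrite ?(h1, h2, h3, h4, h5, h6, h7, h8, h9)
    ?(k1, k2, k3, k4, k5, k6, k7, k8, k9).
Qed.

Definition D (A : alg n) : mstruct := substruct (@D_op_stable A).

Definition sort_prod (X : mstruct) : alg n :=
  prod_alg (fun k => prod_alg (fun _ : X k => Malg k)).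

Lemma discrete_cont (U : topologicalType) (V W : nat) (f : U -> J V)
  (h : J V -> J W) : continuous f -> continuous (h \o f).
Proof.
move=> cf x; apply: continuous_comp; first exact: cf.
by move=> B; rewrite !nbhs_principalE => /principal_filterP Bh;
  apply/principal_filterP.
Qed.

Lemma discrete_cont2 (U : topologicalType) (V : nat) (f g : U -> J V)
    (h : J V -> J V -> J V) :
  continuous f -> continuous g -> continuous (fun x => h (f x) (g x)).
Proof.
move=> cf cg x B; rewrite nbhs_principalE => /principal_filterP Bh.
have fx : nbhs x (f @^-1` [set f x]).
  by apply: cf; rewrite nbhs_principalE; apply/principal_filterP.
have gx : nbhs x (g @^-1` [set g x]).
  by apply: cg; rewrite nbhs_principalE; apply/principal_filterP.
by apply: filterS (filterI fx gx) => y [/= -> ->].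
Qed.

Lemma E_subuniverse (X : mstruct) :
  subuniverse (A := sort_prod X)
    [set phi : sort_prod X | is_mor (X := X) (Y := self) phi].
Proof.
split=> /=.
- move=> x y [cx ox rx] [cy oy ry]; split=> /= [k|g gG a|r rR a b ab].
  + exact: (@discrete_cont2 (X k) (0 < k)%N _ _ (@kmeet _) (cx k) (cy k)).
  + by rewrite ox oy /= (hom_otimes (aops_hom gG)).
  + exact: (@sub_otimes _ _ _ (arels_sub rR) (x _ a, x _ b) (y _ a, y _ b)
      (rx _ rR _ _ ab) (ry _ rR _ _ ab)).
- move=> x y [cx ox rx] [cy oy ry]; split=> /= [k|g gG a|r rR a b ab].
  + exact: (@discrete_cont2 (X k) (0 < k)%N _ _ (@kjoin _) (cx k) (cy k)).
  + by rewrite ox oy /= (hom_oplus (aops_hom gG)).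
  + exact: (@sub_oplus _ _ _ (arels_sub rR) (x _ a, x _ b) (y _ a, y _ b)
      (rx _ rR _ _ ab) (ry _ rR _ _ ab)).
- move=> x y [cx ox rx] [cy oy ry]; split=> /= [k|g gG a|r rR a b ab].
  + exact: (@discrete_cont2 (X k) (0 < k)%N _ _ (@tmeet _) (cx k) (cy k)).
  + by rewrite ox oy /= (hom_wedge (aops_hom gG)).
  + exact: (@sub_wedge _ _ _ (arels_sub rR) (x _ a, x _ b) (y _ a, y _ b)
      (rx _ rR _ _ ab) (ry _ rR _ _ ab)).
- move=> x y [cx ox rx] [cy oy ry]; split=> /= [k|g gG a|r rR a b ab].
  + exact: (@discrete_cont2 (X k) (0 < k)%N _ _ (@tjoin _) (cx k) (cy k)).
  + by rewrite ox oy /= (hom_vee (aops_hom gG)).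
  + exact: (@sub_vee _ _ _ (arels_sub rR) (x _ a, x _ b) (y _ a, y _ b)
      (rx _ rR _ _ ab) (ry _ rR _ _ ab)).
- move=> x [cx ox rx]; split=> /= [k|g gG a|r rR a b ab].
  + exact: (@discrete_cont (X k) (0 < k)%N _ _ (@jneg _) (cx k)).
  + by rewrite ox /= (hom_neg (aops_hom gG)).
  + exact: (@sub_neg _ _ _ (arels_sub rR) (x _ a, x _ b) (rx _ rR _ _ ab)).
- split=> /= [k|g gG a|r rR a b ab]; first exact: cst_continuous.
  + by rewrite (hom_ctop (aops_hom gG)).
  + exact: (sub_ctop (arels_sub rR)).
- split=> /= [k|g gG a|r rR a b ab]; first exact: cst_continuous.
  + by rewrite (hom_cbot (aops_hom gG)).
  + exact: (sub_cbot (arels_sub rR)).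
- move=> i; split=> /= [k|g gG a|r rR a b ab]; first exact: cst_continuous.
  + by rewrite (hom_cf (aops_hom gG)).
  + exact: (sub_cf (arels_sub rR)).
- move=> i; split=> /= [k|g gG a|r rR a b ab]; first exact: cst_continuous.
  + by rewrite (hom_ct (aops_hom gG)).
  + exact: (sub_ct (arels_sub rR)).
Qed.

Definition E (X : mstruct) : alg n := subalg (@E_subuniverse X).

Lemma ev_mor (A : alg n) (a : A) :
  is_mor (X := D A) (Y := self) (fun k x => val x a).
Proof.
split=> //= k x.
apply: (@continuous_comp _ _ _ (@set_val _ _) (fun y : {ptws A -> M k} => y a)).
  exact: initial_continuous.
exact: (@proj_continuous {classic A} (fun=> M k)).
Qed.

Definition ev_alg (A : alg n) (a : A) : E (D A) := exist _ _ (ev_mor a).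

Lemma ev_hom (X : mstruct) (k : 'I_n.+1) (x : X k) :
  (fun alpha : E X => proj1_sig alpha k x) \in
    [set u : E X -> M k | is_hom (B := Malg k) u].
Proof. by rewrite in_setE. Qed.

Definition ev_struct (X : mstruct) (k : 'I_n.+1) (x : X k) : D (E X) k :=
  exist _ (fun alpha : E X => proj1_sig alpha k x) (ev_hom x).

(* K is the class of algebras on which the duality is to be obtained; it is
   meant to be ISP({M_0, ..., M_n}). *)
Definition yields_duality (K : alg n -> Prop) : Prop :=
  forall A : alg n, K A -> is_alg_iso (@ev_alg A).

Definition yields_full_duality (K : alg n -> Prop) : Prop :=
  yields_duality K /\ forall X, IScP X -> is_iso (@ev_struct X).

Definition injective_in_IScP : Prop :=
  forall (X Y : mstruct) (phi : forall k, X k -> Y k)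
    (alpha : forall k, X k -> self k),
    IScP X -> IScP Y -> is_embedding phi -> is_mor alpha ->
    exists beta : forall k, Y k -> self k,
      is_mor beta /\ forall k x, beta k (phi k x) = alpha k x.

Definition yields_strong_duality (K : alg n -> Prop) : Prop :=
  yields_full_duality K /\ injective_in_IScP.

End Structures.

Section Closure.

Lemma mem_op2 (A : eqType) (L : seq A) (h : A -> A -> A) :
  all (fun x => all (fun y => h x y \in L) L) L ->
  forall x y, x \in L -> y \in L -> h x y \in L.
Proof. by move=> /allP H x y /H /allP; apply. Qed.

Lemma mem_op1 (A : eqType) (L : seq A) (h : A -> A) :
  all (fun x => h x \in L) L -> forall x, x \in L -> h x \in L.
Proof. by move=> /allP H x /H. Qed.

Definition le_list (a b : nat) : seq (J a * J b) :=
  [:: (Top, Top); (Bot, Bot);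
      (F ord_max, F ord_max); (F ord_max, F ord0); (F ord0, F ord0);
      (T ord_max, T ord_max); (T ord_max, T ord0); (T ord0, T ord0)].

Lemma le_list2 (a b : bool) : a -> b -> forall x y : J a * J b,
  x \in le_list a b -> y \in le_list a b ->
  [/\ (kmeet x.1 y.1, kmeet x.2 y.2) \in le_list a b,
      (kjoin x.1 y.1, kjoin x.2 y.2) \in le_list a b,
      (tmeet x.1 y.1, tmeet x.2 y.2) \in le_list a b,
      (tjoin x.1 y.1, tjoin x.2 y.2) \in le_list a b
    & (jneg x.1, jneg x.2) \in le_list a b].
Proof.
case: a => //; case: b => // _ _ x y Lx Ly; split.
- by apply: (mem_op2 (h := fun x y => (kmeet x.1 y.1, kmeet x.2 y.2))).
- by apply: (mem_op2 (h := fun x y => (kjoin x.1 y.1, kjoin x.2 y.2))).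
- by apply: (mem_op2 (h := fun x y => (tmeet x.1 y.1, tmeet x.2 y.2))).
- by apply: (mem_op2 (h := fun x y => (tjoin x.1 y.1, tjoin x.2 y.2))).
- by apply: (mem_op1 (h := fun x => (jneg x.1, jneg x.2))).
Qed.

Definition le0_list : seq (J 0 * J 0) :=
  let L := [:: Top; Bot; F ord_max; T ord_max] in
  [seq xy <- [seq (x, y) | x <- L, y <- L] |
    [|| xy.2 == Top, xy.1 == Bot |
        xy \in [:: (F ord_max, F ord_max); (T ord_max, T ord_max)]]].

Lemma le0_listE (xy : J 0 * J 0) : (xy \in le0_list) =
  [|| xy.2 == Top, xy.1 == Bot |
      xy \in [:: (F ord_max, F ord_max); (T ord_max, T ord_max)]].
Proof.
by rewrite mem_filter; case: xy => [[||i|i] [||j|j]];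
  rewrite ?(ord1 i) ?(ord1 j) andbC.
Qed.

Lemma le0_list2 (x y : J 0 * J 0) :
  x \in le0_list -> y \in le0_list ->
  [/\ (kmeet x.1 y.1, kmeet x.2 y.2) \in le0_list,
      (kjoin x.1 y.1, kjoin x.2 y.2) \in le0_list,
      (tmeet x.1 y.1, tmeet x.2 y.2) \in le0_list,
      (tjoin x.1 y.1, tjoin x.2 y.2) \in le0_list
    & (jneg x.1, jneg x.2) \in le0_list].
Proof.
move=> Lx Ly; split.
- by apply: (mem_op2 (h := fun x y => (kmeet x.1 y.1, kmeet x.2 y.2))).
- by apply: (mem_op2 (h := fun x y => (kjoin x.1 y.1, kjoin x.2 y.2))).
- by apply: (mem_op2 (h := fun x y => (tmeet x.1 y.1, tmeet x.2 y.2))).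
- by apply: (mem_op2 (h := fun x y => (tjoin x.1 y.1, tjoin x.2 y.2))).
- by apply: (mem_op1 (h := fun x => (jneg x.1, jneg x.2))).
Qed.

End Closure.

Section Mn.
Variable n : nat.
Implicit Types j k : 'I_n.+1.

Definition le0_set : {set M (n := n) ord0 * M (n := n) ord0} :=
  [set xy | (xy.2 == Top) || (xy.1 == Bot) ||
            (xy \in [:: (fM ord0, fM ord0); (tM ord0, tM ord0)])]%SET.

Definition le0 : msrel n := @Tagged _ (ord0, ord0) _ le0_set.

Definition lejk_set j k : {set M j * M k} :=
  [set xy in [:: (Top, Top); (Bot, Bot);
                 (fM j, fM k); (fM j, zeroM k); (zeroM j, zeroM k);
                 (tM j, tM k); (tM j, oneM k); (oneM j, oneM k)]]%SET.

(* For 0 < j < k this is the relation from M_j to M_k; for j = k > 0 it is the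
   order on M_k. *)
Definition lejk j k : msrel n := @Tagged _ (j, k) _ (lejk_set j k).

Definition gk_fun k : {ffun M k -> M (n := n) ord0} :=
  [ffun x : M k => match x with
     | Top => Top | Bot => Bot | F _ => fM ord0 | T _ => tM ord0
     end].

Definition gk k : msop n := @Tagged _ (k, ord0) _ (gk_fun k).

Definition Gn : {set msop n} := [set gk k | k : 'I_n.+1 & (0 < k)%N]%SET.

Definition Sn : {set msrel n} :=
  (le0 |: ([set lejk k k | k : 'I_n.+1 & (0 < k)%N] :|:
    [set lejk jk.1 jk.2 | jk : 'I_n.+1 * 'I_n.+1
      & (0 < jk.1)%N && (jk.1 < jk.2)%N]))%SET.

Lemma gk_hom k : @is_hom n (Malg k) (Malg ord0) (@app n (gk k)).
Proof.
have tot (i j : 'I_(0 < k).+1) : (i <= j)%N = false -> (j <= i)%N = false ->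
  False by move=> h1 h2; have := leq_total i j; rewrite h1 h2.
split=> //=; rewrite /app /=.
- move=> [||i|i] [||j|j]; rewrite !ffunE //= /kmeet /=;
  by case: ifP => // h1; case: ifP => // h2; case: (tot _ _ h1 h2).
- move=> [||i|i] [||j|j]; rewrite !ffunE //= /kjoin /=;
  by case: ifP => // h1; case: ifP => // h2; case: (tot _ _ h1 h2).
- move=> [||i|i] [||j|j]; rewrite !ffunE //= /tmeet /=;
  by case: ifP => // h1; case: ifP => // h2; case: (tot _ _ h1 h2).
- move=> [||i|i] [||j|j]; rewrite !ffunE //= /tjoin /=;
  by case: ifP => // h1; case: ifP => // h2; case: (tot _ _ h1 h2).
- by move=> [||i|i]; rewrite !ffunE.
- by rewrite ffunE.
- by rewrite ffunE.
- by move=> i; rewrite ffunE; case: ifP.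
- by move=> i; rewrite ffunE; case: ifP.
Qed.

Lemma le0P (xy : J 0 * J 0) : (xy \in le0_set) = (xy \in le0_list).
Proof. by rewrite le0_listE inE orbA. Qed.

Lemma le0_sub : @subuniverse n (pair_alg (Malg ord0) (Malg ord0))
  [set xy | @holds n le0 xy.1 xy.2].
Proof.
have h (xy : J 0 * J 0) : @holds n le0 xy.1 xy.2 <-> xy \in le0_list.
  by rewrite /holds -le0P -surjective_pairing.
split=> [x y|x y|x y|x y|x|||i|i] /=.
- by move=> /h Lx /h Ly; apply/(h (_, _)); case: (le0_list2 Lx Ly).
- by move=> /h Lx /h Ly; apply/(h (_, _)); case: (le0_list2 Lx Ly).
- by move=> /h Lx /h Ly; apply/(h (_, _)); case: (le0_list2 Lx Ly).
- by move=> /h Lx /h Ly; apply/(h (_, _)); case: (le0_list2 Lx Ly).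
- by move=> /h Lx; apply/(h (_, _)); case: (le0_list2 Lx Lx).
- exact/(h (_, _)).
- exact/(h (_, _)).
- exact/(h (_, _)).
- exact/(h (_, _)).
Qed.

Lemma lejk_sub j k : (0 < j)%N -> (j <= k)%N ->
  @subuniverse n (pair_alg (Malg j) (Malg k))
    [set xy | @holds n (lejk j k) xy.1 xy.2].
Proof.
move=> j0 jk; have k0 : (0 < k)%N by apply: leq_trans jk.
have h (xy : J (0 < j)%N * J (0 < k)%N) :
    @holds n (lejk j k) xy.1 xy.2 <-> xy \in le_list (0 < j)%N (0 < k)%N.
  by rewrite /holds -surjective_pairing /= inE.
split=> [x y|x y|x y|x y|x|||i|i] /=.
- by move=> /h Lx /h Ly; apply/(h (_, _)); case: (le_list2 j0 k0 Lx Ly).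
- by move=> /h Lx /h Ly; apply/(h (_, _)); case: (le_list2 j0 k0 Lx Ly).
- by move=> /h Lx /h Ly; apply/(h (_, _)); case: (le_list2 j0 k0 Lx Ly).
- by move=> /h Lx /h Ly; apply/(h (_, _)); case: (le_list2 j0 k0 Lx Ly).
- by move=> /h Lx; apply/(h (_, _)); case: (le_list2 j0 k0 Lx Lx).
- exact/(h (_, _)).
- exact/(h (_, _)).
- case: (leqP j i) => ij; last first.
    by rewrite (leq_trans ij jk); apply/(h (_, _)); rewrite !inE eqxx ?orbT.
  by case: (leqP k i) => _; apply/(h (_, _)); rewrite !inE eqxx ?orbT.
- case: (leqP j i) => ij; last first.
    by rewrite (leq_trans ij jk); apply/(h (_, _)); rewrite !inE eqxx ?orbT.
  by case: (leqP k i) => _; apply/(h (_, _)); rewrite !inE eqxx ?orbT.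
Qed.

Lemma Gn_hom g : g \in Gn ->
  @is_hom n (Malg (src g)) (Malg (tgt g)) (@app n g).
Proof. by case/imsetP=> k _ ->; apply: gk_hom. Qed.

Lemma Sn_sub r : r \in Sn ->
  @subuniverse n (pair_alg (Malg (rsrc r)) (Malg (rtgt r)))
    [set xy | holds xy.1 xy.2].
Proof.
rewrite !finset.in_setU finset.in_set1 => /or3P[/eqP->|/imsetP[k]|/imsetP[[j k]]].
- exact: le0_sub.
- by rewrite inE => k0 ->; apply: lejk_sub.
- by rewrite inE => /andP[/= j0 jk] ->; apply: lejk_sub => //; apply: ltnW.
Qed.

Lemma Sn_nonempty r : r \in Sn -> exists x y, @holds n r x y.
Proof.
move=> /Sn_sub sR; exists (ctop (Malg (rsrc r))), (ctop (Malg (rtgt r))).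
exact: (sub_ctop sR).
Qed.

Definition Mn : alter_ego n := AlterEgo Gn_hom Sn_sub Sn_nonempty.

End Mn.

(* The graph of an operation, i.e. the operation regarded as a set of pairs,
   so that S_(n) and G_(n) become subsets of one type. *)
Definition graph (n : nat) (g : msop n) : msrel n :=
  @Tagged _ (tag g) _ [set xy | xy.2 == tagged g xy.1]%SET.

Definition HSP_J (n : nat) : alg n -> Prop :=
  classH (classS (classP (fun A => A = Jalg n))).

Definition ISP_M (n : nat) : alg n -> Prop :=
  classI (classS (classP (fun A => exists k : 'I_n.+1, A = Malg k))).

(* Main.v *)
Require Import Defs.
From mathcomp Require Import all_boot all_order all_algebra.
From mathcomp Require Import all_classical topology.
From mathcomp Require Import zify.

(** Piggyback on Priestley duality for the truth lattice, which is a
    distributive lattice in every algebra of the variety.  The prime filters of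
    the truth lattice of M_k are preimages, under the identity or g_k, of
    {1} (resp. {top, t} when k = 0) or of its "negation"; call these two kinds
    of filters the characters of a sort.

    - HSP(J_n) is contained in ISP(M_0, ..., M_n): a prime filter of the truth
      lattice of a quotient A/theta is, by an ultrafilter argument, a character
      of some homomorphism u : A -> M_k, and the kernel of u contains theta
      because unary terms and a character together separate the points of M_k.
    - Duality and injectivity: if one character of x lies below another
      character of y on all of A, then x and y (or their images under the g_k)
      are related by one of the relations of the alter ego, so a morphism alpha
      respects that inclusion.  Two directed compactness arguments then give an
      element of A at which every x takes the value alpha(x).
    - Fullness: for u : E(X) -> M_k, a Jonsson-type argument (pairs witnessing
      that ker u does not contain ker(ev_x) can be combined into one pair, and X
      is compact) gives a point x with ker(ev_x) contained in ker u.  As all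
      elements of the sorts are named by constants, u is evaluation at x or at
      g_j(x). *)

Set Implicit Arguments.
Unset Strict Implicit.
Unset Printing Implicit Defensive.

Local Open Scope classical_set_scope.

(** * Characters of the sorts *)

(** The sorts are [J b] with [b] boolean, so every index is [ord0] or [ord_max]; identities on the
    sorts thus become finite checks. *)
Lemma J_case (b : bool) (P : J b -> Prop) :
  P Top -> P Bot -> P (F ord0) -> P (F ord_max) -> P (T ord0) ->
  P (T ord_max) -> forall x, P x.
Proof.
have ordE (i : 'I_b.+1) : i = ord0 \/ i = ord_max.
  case: b i {P} => -[[|[|i]] i_lt] //; first [by left; apply: val_inj
    | by right; apply: val_inj].
by move=> ? ? ? ? ? ? [||i|i] //; have [->|->] := ordE i.
Qed.

Definition desig (m : nat) (x : J m) : bool :=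
  match x with
  | Top => m == 0%N | T i => (i : nat) == 0%N | _ => false
  end.

Definition up (m : nat) (x : J m) : bool :=
  match x with Top | T _ => true | _ => false end.

(* On M_k, these are the prime filters of the truth lattice that do not come
   from M_0 along g_k; on M_0 they are all of its prime filters. *)
Definition char (m : nat) (s : bool) (x : J m) : bool :=
  if s then desig x else ~~ desig (jneg x).

Lemma jnegK (m : nat) : involutive (@jneg m).
Proof. by case. Qed.

Lemma char_tmeet (b s : bool) (x y : J b) :
  char s (tmeet x y) = char s x && char s y.
Proof.
by case: b x y => x y; case: s; elim/J_case: x; elim/J_case: y.
Qed.

Lemma char_tjoin (b s : bool) (x y : J b) :
  char s (tjoin x y) = char s x || char s y.
Proof.
by case: b x y => x y; case: s; elim/J_case: x; elim/J_case: y.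
Qed.

(** Together with the filters pulled back from M_0, which [up] describes, the characters give all
    prime filters of the truth lattice, and these separate points. *)
Lemma char_up_inj (b : bool) (x y : J b) :
  (forall s, char s x = char s y) -> up x = up y ->
  up (jneg x) = up (jneg y) -> x = y.
Proof.
move=> h; move: (h true) (h false) => {h}.
by case: b x y => x y; elim/J_case: x; elim/J_case: y => // *;
  congr (_ _); apply: val_inj.
Qed.

Section Sorts.
Variable n : nat.
Implicit Types k : 'I_n.+1.

Lemma cf_ord0 k : cf (Malg k) ord0 = F ord0.
Proof.
by rewrite /= /zeroM /fM /M; case: (0 < k)%N => //; congr F; apply: val_inj.
Qed.

Lemma cf_ord_max k : cf (Malg k) ord_max = F ord_max.
Proof. by rewrite /= ltnNge -ltnS ltn_ord. Qed.

Lemma ct_ord0 k : ct (Malg k) ord0 = T ord0.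
Proof.
by rewrite /= /oneM /tM /M; case: (0 < k)%N => //; congr T; apply: val_inj.
Qed.

Lemma ct_ord_max k : ct (Malg k) ord_max = T ord_max.
Proof. by rewrite /= ltnNge -ltnS ltn_ord. Qed.

Lemma is_hom_comp (A B C : alg n) (g : B -> C) (h : A -> B) :
  is_hom g -> is_hom h -> is_hom (g \o h).
Proof.
move=> [g1 g2 g3 g4 g5 g6 g7 g8 g9] [h1 h2 h3 h4 h5 h6 h7 h8 h9].
by split=> *; rewrite /= ?h1 ?h2 ?h3 ?h4 ?h5 ?h6 ?h7 ?h8 ?h9.
Qed.

Definition g_ k : Malg k -> Malg ord0 := @app n (gk k).

Lemma desig_g k (x : Malg k) : desig (g_ x : M ord0) = up x.
Proof. by rewrite /g_ /app /= ffunE; case: x. Qed.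

Lemma desig_jneg_g k (x : Malg k) : desig (jneg (g_ x : M ord0)) = up (jneg x).
Proof. by rewrite /g_ /app /= ffunE; case: x. Qed.

Definition separated (A : alg n) : Prop := forall a b : A,
  (forall k (h : A -> Malg k), is_hom h -> h a = h b) -> a = b.

Lemma char_sep (A : alg n) (a b : A) : separated A ->
  (forall k s (h : A -> Malg k), is_hom h -> char s (h a) = char s (h b)) ->
  a = b.
Proof.
move=> sepA ab; apply: sepA => k h h_hom.
have gh_hom := is_hom_comp (gk_hom k) h_hom.
apply: char_up_inj => [s||]; first exact: ab.
  by have := ab _ true _ gh_hom; rewrite /char !desig_g.
by have := ab _ false _ gh_hom; rewrite /char !desig_jneg_g => /negb_inj.
Qed.

End Sorts.

(** * Unary terms separating the elements of a sort *)

Section UnaryTerms.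
Variable n : nat.
Implicit Types (k : 'I_n.+1) (A B : alg n).

(** Stands in for unary terms, without a syntax: only compatibility with homomorphisms is used. *)
Definition natural (tau : forall A : alg n, A -> A) : Prop :=
  forall (A B : alg n) (h : A -> B), is_hom h ->
    forall a, h (tau A a) = tau B (h a).

(* The pair (F ord0, low) generates the least nontrivial congruence of M_k. *)
Definition low (b : bool) : J b := if b then F ord_max else Bot.

(** In M_k with [b] equal to [0 < k], the steps after [x2] collapse everything to [F ord0] or
    [low b]; the choices of [i] and [j] give four such splittings, which together separate
    points. *)
Definition probe (b i j : bool) (A : alg n) (x : A) : A :=
  let x1 := if i then neg x else x in
  let x2 := if j then oplus x1 (ct A ord_max) else x1 in
  let x3 := otimes x2 (cf A ord0) in
  if b then wedge x3 (cf A ord_max) else x3.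

Lemma probe_natural b i j : natural (probe b i j).
Proof.
move=> A B h hh a; rewrite /probe.
by case: b i j => [] [] [];
  rewrite ?(hom_wedge hh) ?(hom_otimes hh) ?(hom_oplus hh) ?(hom_neg hh)
    ?(hom_cf hh) ?(hom_ct hh).
Qed.

Lemma J_probe (b : bool) (x y : J b) : x != y ->
  let f i j z := let z1 := if i then jneg z else z in
    let z2 := if j then kjoin z1 (T ord_max) else z1 in
    let z3 := kmeet z2 (F ord0) in if b then tmeet z3 (F ord_max) else z3 in
  exists i j, (f i j x == F ord0) && (f i j y == low b) ||
    (f i j y == F ord0) && (f i j x == low b).
Proof.
move=> xy f; pose g i j := (f i j x == F ord0) && (f i j y == low b) ||
  (f i j y == F ord0) && (f i j x == low b).
suff : [|| g false false, g true false, g false true | g true true].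
  by case/or4P; eexists; eexists; eassumption.
by rewrite {}/g {}/f; case: b x y xy => x y; elim/J_case: x; elim/J_case: y.
Qed.

(** Some [probe] sends any two distinct points to the generators of the least nontrivial congruence,
    which gives every separated pair a normal form. *)
Lemma probe_sep k (x y : Malg k) : x <> y -> exists2 tau, natural tau &
  tau _ x = F ord0 /\ tau _ y = low (0 < k) \/
  tau _ y = F ord0 /\ tau _ x = low (0 < k).
Proof.
move/eqP/J_probe => /= [i [j ij]].
exists (probe (0 < k) i j); first exact: probe_natural.
rewrite /probe cf_ord0 cf_ord_max ct_ord_max.
by case/orP: ij => /andP[/eqP e1 /eqP e2]; [left|right].
Qed.

Lemma probe_char k s (x y : Malg k) : x <> y ->
  exists2 tau, natural tau & char s (tau _ x) != char s (tau _ y).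
Proof.
case/probe_sep=> tau tauN xy.
(* [char false] separates [F ord0] from [low (0 < k)]; after negation [char true] does. *)
exists (fun A a => if s then neg (tau A a) else tau A a).
  move=> A B h hh a; case: s; rewrite -(tauN _ _ _ hh) //.
  by rewrite (hom_neg hh).
have lowF : desig (jneg (low (0 < k))) = false by rewrite /M; case: (0 < k)%N.
by case: s; rewrite /char /=; case: xy => -[-> ->]; rewrite /= lowF.
Qed.

End UnaryTerms.

(** * Ultrafilter limits and quotients *)

Lemma ultra_fin (T : Type) (V : finType) (U : set_system T) (f : T -> V) :
  UltraFilter U -> exists v, U (f @^-1` [set v]).
Proof.
move=> UU; apply: contrapT => /forallNP nU.
suff : U (f @^-1` [set v | v \in enum V] `&` ~` [set: T]).
  by rewrite setCT setI0; apply: filter_not_empty.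
suff H (s : seq V) : U (~` (f @^-1` [set v | v \in s])).
  have := H (enum V); congr U; apply/seteqP; split=> t /=.
    by rewrite mem_enum.
  by case=> _ [].
elim: s => [|v s IH].
  by apply: filterS filterT => t _.
have [/nU//|Uv] := in_ultra_setVsetC (f @^-1` [set v]) UU.
apply: filterS (filterI Uv IH) => t [/= tv ts].
by rewrite inE => /orP[/eqP|].
Qed.

Section Limit.
Variables (n : nat) (A : alg n).
Implicit Types (k : 'I_n.+1).

Record point := Point {
  psort : 'I_n.+1;
  pmap :> A -> Malg psort;
  pmap_hom : is_hom pmap }.

Let tM k (x : M k) : {k : 'I_n.+1 & M k} := Tagged _ x.

Lemma tagged_op1 (f : forall k, M k -> M k) k k' (x : M k) (x' : M k') :
  tM x = tM x' -> tM (f _ x) = tM (f _ x').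
Proof. exact: (congr1 (fun z => tM (f (tag z) (tagged z)))). Qed.

Lemma tagged_op2 (f : forall k, M k -> M k -> M k) k k' (x y : M k) (x' y' : M k') :
  tM x = tM x' -> tM y = tM y' -> tM (f _ x y) = tM (f _ x' y').
Proof.
move=> xx yy; have kk : k = k' := congr1 tag xx.
move: x y xx yy; rewrite kk => x y.
by do 2![move=> /eqP; rewrite eq_Tagged => /eqP /= ->].
Qed.

Lemma Tagged_M_inj k : injective (@tM k).
Proof. by move=> x y /eqP; rewrite eq_Tagged => /eqP. Qed.

(** There are finitely many tagged values, so [U] decides the sort, the character and each value.
    Every homomorphism equation involves at most three arguments and holds at some point agreeing
    there with the limit. *)
Lemma ultra_limit (U : set_system (point * bool)) : UltraFilter U ->
  exists (p : point) (s : bool), forall a,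
    U [set y : point * bool | char y.2 (pmap y.1 a) = char s (p a)].
Proof.
move=> UU.
have [s Us] := ultra_fin (fun y : point * bool => y.2) UU.
have [k Uk] := ultra_fin (fun y : point * bool => psort y.1) UU.
have /choice[u Uu] a : exists x : M k, U [set y : point * bool | tM (pmap y.1 a) = tM x].
  have [[k' x] Ux] := ultra_fin (fun y : point * bool => tM (pmap y.1 a)) UU.
  have [y [yk yx]] := filter_ex (filterI Uk Ux).
  have kk : k' = k by rewrite -yk; exact: (esym (congr1 tag yx)).
  by move: x Ux {yx}; rewrite kk => x; exists x.
have uP (P : Prop) (L : seq A) :
    (forall y : point * bool,
      (forall a, a \in (L : seq {classic A}) -> tM (pmap y.1 a) = tM (u a)) -> P) -> P.
  suff UL : U [set y : point * bool | forall a, a \in (L : seq {classic A}) ->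
      tM (pmap y.1 a) = tM (u a)].
    by have [y yL] := filter_ex UL => /(_ y yL).
  elim: L => [|a L IH].
    by apply: filterS filterT => y _ a.
  apply: filterS (filterI (Uu a) IH) => y [/= ya yL] b.
  by rewrite inE => /orP[/eqP->|/yL].
have in1 (a b c : {classic A}) : a \in [:: a; b; c] by rewrite inE eqxx.
have in2 (a b c : {classic A}) : b \in [:: a; b; c].
  by rewrite !inE eqxx orbT.
have in3 (a b c : {classic A}) : c \in [:: a; b; c].
  by rewrite !inE eqxx !orbT.
have op2 (fA : A -> A -> A) (f : forall k, M k -> M k -> M k) :
    (forall (y : point) a b, y (fA a b) = f _ (y a) (y b)) ->
    forall a b, u (fA a b) = f _ (u a) (u b).
  move=> fP a b; apply: (uP _ [:: a; b; fA a b]) => y yL.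
  apply: Tagged_M_inj; rewrite -(yL _ (in3 _ _ _)) fP.
  by apply: tagged_op2; apply: yL; [exact: in1|exact: in2].
have op1 (fA : A -> A) (f : forall k, M k -> M k) :
    (forall (y : point) a, y (fA a) = f _ (y a)) ->
    forall a, u (fA a) = f _ (u a).
  move=> fP a; apply: (uP _ [:: a; a; fA a]) => y yL.
  apply: Tagged_M_inj; rewrite -(yL _ (in3 _ _ _)) fP.
  by apply: tagged_op1; apply: yL; exact: in1.
have op0 (a : A) (f : forall k, M k) :
    (forall y : point, y a = f _) -> u a = f k.
  move=> fP; apply: (uP _ [:: a; a; a]) => y yL.
  apply: Tagged_M_inj; rewrite -(yL _ (in3 _ _ _)) fP.
  have kk := congr1 tag (yL _ (in1 _ _ _)).
  by move: kk => /= ->.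
have u_hom : is_hom (B := Malg k) u.
  split.
  - by apply: (op2 _ (fun k => @otimes _ (Malg k))) => -[? h []].
  - by apply: (op2 _ (fun k => @oplus _ (Malg k))) => -[? h []].
  - by apply: (op2 _ (fun k => @wedge _ (Malg k))) => -[? h []].
  - by apply: (op2 _ (fun k => @vee _ (Malg k))) => -[? h []].
  - by apply: (op1 _ (fun k => @neg _ (Malg k))) => -[? h []].
  - by apply: (op0 _ (fun k => ctop (Malg k))) => -[? h []].
  - by apply: (op0 _ (fun k => cbot (Malg k))) => -[? h []].
  - by move=> i; apply: (op0 _ (fun k => cf (Malg k) i)) => -[? h []].
  - by move=> i; apply: (op0 _ (fun k => ct (Malg k) i)) => -[? h []].
exists (Point u_hom), s => a; apply: filterS (filterI Us (Uu a)) => y [/= -> ya].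
exact: (congr1 (fun z => char s (tagged z)) ya).
Qed.

End Limit.

Lemma hom_factor n (A B C : alg n) (q : A -> B) (p : A -> C) (u : B -> C) :
  is_hom q -> (forall b, exists a, q a = b) -> is_hom p ->
  (forall a, u (q a) = p a) -> is_hom u.
Proof.
move=> [q1 q2 q3 q4 q5 q6 q7 q8 q9] q_onto [p1 p2 p3 p4 p5 p6 p7 p8 p9] uq.
split=> [x y|x y|x y|x y|x|||i|i].
- by have [[a <-] [b <-]] := (q_onto x, q_onto y); rewrite -q1 !uq p1.
- by have [[a <-] [b <-]] := (q_onto x, q_onto y); rewrite -q2 !uq p2.
- by have [[a <-] [b <-]] := (q_onto x, q_onto y); rewrite -q3 !uq p3.
- by have [[a <-] [b <-]] := (q_onto x, q_onto y); rewrite -q4 !uq p4.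
- by have [a <-] := q_onto x; rewrite -q5 !uq p5.
- by rewrite -q6 uq p6.
- by rewrite -q7 uq p7.
- by rewrite -q8 uq p8.
- by rewrite -q9 uq p9.
Qed.

(** * Quotients of separated algebras *)

Section Quotient.
Variables (n : nat) (A B : alg n) (q : A -> B).
Hypotheses (sepA : separated A) (q_hom : is_hom q).

Let tle (c d : A) : Prop := q (wedge c d) = q c.

(* If the sets {char c holds, char d fails} for c below d modulo ker q cover
   {char a holds, char a' fails}, then a is below a' modulo ker q; induction
   on the cover, resolving the pair (c, d) between (a /\ d, a') and
   (a, a' \/ c). *)
Lemma tle_cover (L : seq (A * A)) (a a' : A) :
  (forall cd, List.In cd L -> tle cd.1 cd.2) ->
  (forall (p : point A) s, char s (p a) -> ~~ char s (p a') ->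
    exists cd, [/\ List.In cd L, char s (p cd.1) & ~~ char s (p cd.2)]) ->
  tle a a'.
Proof.
elim: L a a' => [|[c d] L IH] a a' Lle cov.
  congr q; apply: char_sep => // k s h h_hom.
  rewrite (hom_wedge h_hom) char_tmeet.
  case ha: (char s (h a)) => //=; apply: contrapT => /negP ha'.
  by have [? []] := cov (Point h_hom) s ha ha'.
have cd : tle c d by apply: (Lle (c, d)); left.
have adP : tle (wedge a d) a'.
  apply: IH => [? ?|p s]; first by apply: Lle; right.
  rewrite (hom_wedge (pmap_hom p)) char_tmeet => /andP[pa pd] pa'.
  have [e [[<-|eL] pe1 pe2]] := cov p s pa pa'; first by rewrite /= pd in pe2.
  by exists e.
have acP : tle a (vee a' c).
  apply: IH => [? ?|p s]; first by apply: Lle; right.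
  rewrite (hom_vee (pmap_hom p)) char_tjoin negb_or => pa /andP[pa' pc].
  have [e [[<-|eL] pe1 pe2]] := cov p s pa pa'.
    by rewrite /= (negPf pc) in pe1.
  by exists e.
(* Modulo [ker q], [acP] writes [a] as its meet with [vee a' c]; replacing [c] by [wedge c d],
   expanding by [e1], and using [adP] and [e2] leaves [wedge a a']. *)
have e1 : wedge a (vee a' (wedge c d)) =
    vee (wedge a a') (wedge (wedge a d) c).
  apply: char_sep => // k s h hh.
  rewrite ?(hom_wedge hh, hom_vee hh) ?(char_tmeet, char_tjoin).
  by case: (char s (h a)) (char s (h a')) (char s (h c)) (char s (h d))
    => [] [] [] [].
have e2 : vee (wedge a a') (wedge (wedge (wedge a d) a') c) = wedge a a'.
  apply: char_sep => // k s h hh.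
  rewrite ?(hom_wedge hh, hom_vee hh) ?(char_tmeet, char_tjoin).
  by case: (char s (h a)) (char s (h a')) (char s (h c)) (char s (h d))
    => [] [] [] [].
rewrite /tle -acP (hom_wedge q_hom a (vee a' c)) (hom_vee q_hom) -cd -(hom_vee q_hom).
rewrite -(hom_wedge q_hom) e1 (hom_vee q_hom) (hom_wedge q_hom _ c) -adP.
by rewrite -(hom_wedge q_hom) -(hom_vee q_hom) e2.
Qed.

(** Otherwise, by [tle_cover], finitely many inequalities modulo [ker q] never exclude all
    characters holding at [a] and failing at [a']. An ultrafilter limit of these respects all the
    inequalities, and its homomorphism factors through [q], against the hypothesis. *)
Lemma tle_quotient (q_onto : forall b, exists a, q a = b) (a a' : A) :
  (forall k (h : B -> Malg k), is_hom h -> h (q a) = h (q a')) -> tle a a'.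
Proof.
move=> qaa; apply: contrapT => naa.
pose good (L : seq (A * A)) := forall cd, List.In cd L -> tle cd.1 cd.2.
pose S L := [set y : point A * bool | [/\ char y.2 (pmap y.1 a),
  ~~ char y.2 (pmap y.1 a') & forall cd, List.In cd L ->
    char y.2 (pmap y.1 cd.1) -> char y.2 (pmap y.1 cd.2)]].
have FF : ProperFilter (filter_from good S).
  apply: filter_from_proper => [|L Lgood]; last first.
    apply: contrapT => S0; apply/naa/(tle_cover Lgood) => p s pa pa'.
    apply: contrapT => nL; apply: S0; exists (p, s); split=> //= cd cdL pc.
    by apply: contrapT => /negP pd; apply: nL; exists cd.
  apply: filter_from_filter; first by exists [::].
  move=> L1 L2 g1 g2; exists (L1 ++ L2).
    by move=> cd cdL; have [/g1|/g2] := List.in_app_or _ _ _ cdL.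
  move=> y [ya ya' yL]; split; split=> // cd cdL; apply: yL.
    by apply: (List.in_or_app L1 L2 cd); left.
  by apply: (List.in_or_app L1 L2 cd); right.
have [U [UU FU]] := ultraFilterLemma FF.
have [p [s ps]] := ultra_limit UU.
have US L : good L -> U (S L) by move=> gL; apply: FU; exists L.
have p_tle c d : tle c d -> char s (p c) -> char s (p d).
  move=> cd pc.
  have /US USL : good [:: (c, d)] by move=> _ [<-|[]].
  have [y [[[_ _ yL] yc] yd]] := filter_ex (filterI (filterI USL (ps c)) (ps d)).
  by move: yc yd pc => /= <- <-; apply: (yL (c, d)); left.
have [pa pa'] : char s (p a) /\ ~~ char s (p a').
  have /US USL : good [::] by move=> _ [].
  have [y [[[ya ya' _] yc] yd]] :=
    filter_ex (filterI (filterI USL (ps a)) (ps a')).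
  by move: yc yd => /= <- <-.
have tle_eq c d : q c = q d -> tle c d.
  move=> cd; rewrite /tle (hom_wedge q_hom) -cd -(hom_wedge q_hom); congr q.
  apply: char_sep => // k s' h hh.
  by rewrite (hom_wedge hh) char_tmeet andbb.
have p_eq c d : q c = q d -> char s (p c) = char s (p d).
  by move=> cd; apply/idP/idP; apply: p_tle; apply: tle_eq.
(* If [p c] and [p d] differed, a unary term would give elements with equal images under [q] but
   different characters, against [p_eq]. *)
have p_ker c d : q c = q d -> p c = p d.
  move=> cd; apply: contrapT => /(probe_char s) [tau tauN] /negP; apply.
  rewrite -!(tauN _ _ _ (pmap_hom p)); apply/eqP/p_eq.
  by rewrite !(tauN _ _ _ q_hom) cd.
have [r qr] := choice q_onto.
have pr c : (p \o r) (q c) = p c by apply: p_ker; rewrite qr.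
have v_hom : is_hom (B := Malg (psort p)) (p \o r).
  exact: (hom_factor q_hom q_onto (pmap_hom p)).
by have := qaa _ _ v_hom; rewrite !pr => paa; rewrite -paa pa in pa'.
Qed.

Lemma separated_quotient : (forall b, exists a, q a = b) -> separated B.
Proof.
move=> q_onto b b'; have [a <-] := q_onto b; have [a' <-] := q_onto b' => haa.
have aa := tle_quotient q_onto haa.
have a'a : tle a' a by apply: tle_quotient => // k h hh; rewrite haa.
rewrite -aa -[RHS]a'a; congr q; apply: char_sep => // k s h hh.
by rewrite !(hom_wedge hh) !char_tmeet andbC.
Qed.

End Quotient.

(** * The variety as a quasivariety *)

Lemma sval_inj (T : Type) (P : T -> Prop) : injective (@sval T P).
Proof. by move=> [x Px] [y Py] /= xy; apply: eq_exist. Qed.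

Section Variety.
Variable n : nat.
Implicit Types (k : 'I_n.+1) (A B : alg n).

Definition Jproj k (x : Jalg n) : Malg k :=
  match x with
  | Top => Top | Bot => Bot | F i => cf (Malg k) i | T i => ct (Malg k) i
  end.

(** The index map [f] is monotone and fixes [ord_max], the index of the truth meet and truth join of
    top and bottom. *)
Lemma Jproj_hom k : is_hom (@Jproj k).
Proof.
pose f (i : 'I_n.+1) : 'I_(0 < k).+1 := if i < k then ord0 else ord_max.
have f_homo (i j : 'I_n.+1) : (i <= j)%N -> (f i <= f j)%N.
  rewrite /f => ij; case: (ltnP i k) => // ik.
  by have -> : (j < k) = false by rewrite ltnNge (leq_trans ik ij).
have nk : (n < k) = false by rewrite ltnNge -ltnS ltn_ord.
have f_max : f ord_max = ord_max by rewrite /f /= nk.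
pose g (x : J n) : J (0 < k) :=
  match x with Top => Top | Bot => Bot | F i => F (f i) | T i => T (f i) end.
have gE : @Jproj k = g.
  by apply/funext => -[||i|i] //=; rewrite /f; case: ifP.
rewrite gE; split=> [x y|x y|x y|x y|x|||i|i] //=; last first.
- by rewrite /f; case: ifP.
- by rewrite /f; case: ifP.
- by case: x.
all: case: x y => [||i|i] [||j|j] //=; rewrite /kmeet /kjoin /tmeet /tjoin //=.
all: rewrite ?f_max //.
all: have [ij|ij|/val_inj ->] := ltngtP i j; rewrite /= ?leqnn //.
all: have := f_homo _ _ (ltnW ij); case: (ltngtP (f i) (f j)) => //= + _.
all: by move/val_inj->.
Qed.

Lemma Jalg_separated : separated (Jalg n).
Proof.
have jk (i j : 'I_n.+1) : (forall k, (i < k) = (j < k)) -> i = j.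
  move=> ij; apply: val_inj; apply/eqP; rewrite eqn_leq.
  by rewrite (leqNgt i) (leqNgt j) (ij j) -(ij i) !ltnn.
have FE k (i : 'I_n.+1) : 0 < k -> (cf (Malg k) i == F ord0) = (i < k).
  by rewrite /= /zeroM /fM /M => k0; case: ifP; case: (0 < k) k0.
have TE k (i : 'I_n.+1) : 0 < k -> (ct (Malg k) i == T ord0) = (i < k).
  by rewrite /= /oneM /tM /M => k0; case: ifP; case: (0 < k) k0.
have lt k (i : 'I_n.+1) : (0 < k -> forall j : 'I_n.+1, (i < k) = (j < k)) ->
  forall j : 'I_n.+1, (i < k) = (j < k).
  by move=> h j; case: (posnP k) => [->//|/h].
move=> a b ab; have {}ab k : @Jproj k a = @Jproj k b by apply/ab/Jproj_hom.
move: a b ab => [||i|i] [||j|j] ab //; move: (ab ord0) => //=; rewrite ?ltn0 //.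
- move=> _; congr F; apply: jk => k; case: (posnP k) => [->//|k0].
  by have /(congr1 (fun x => x == F ord0)) := ab k; rewrite /= !FE.
- move=> _; congr T; apply: jk => k; case: (posnP k) => [->//|k0].
  by have /(congr1 (fun x => x == T ord0)) := ab k; rewrite /= !TE.
Qed.

Lemma separated_sub A (U : set A) (sU : subuniverse U) :
  separated A -> separated (subalg sU).
Proof.
move=> sepA a b ab; apply/sval_inj/sepA => k h hh.
have : is_hom (A := subalg sU) (h \o sval).
  apply: is_hom_comp hh _; by split.
exact: ab.
Qed.

Lemma prod_alg_ext (I : Type) (G : I -> alg n) (x y : prod_alg G) :
  (forall i, x i = y i) -> x = y.
Proof. exact: functional_extensionality_dep. Qed.

Lemma separated_prod (I : Type) (G : I -> alg n) :
  (forall i, separated (G i)) -> separated (prod_alg G).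
Proof.
move=> sepG a b ab; apply: prod_alg_ext => i; apply: sepG => k h hh.
have : is_hom (A := prod_alg G) (h \o (fun x => x i)).
  apply: is_hom_comp hh _; by split.
exact: ab.
Qed.

Lemma HSP_J_separated A : HSP_J A -> separated A.
Proof.
move=> [B [[C [U [sU [[I [G [GJ C_prod]]] ->]]]] [h [h_hom h_onto]]]].
apply: separated_quotient h_hom h_onto; apply: separated_sub.
rewrite C_prod; apply: separated_prod => i; rewrite GJ; exact: Jalg_separated.
Qed.

Lemma separated_ISP_M A : separated A -> ISP_M A.
Proof.
move=> sepA; pose G (p : point A) := Malg (psort p).
pose e (a : A) : prod_alg G := fun p => p a.
have e_hom : is_hom e.
  by split=> *; apply: prod_alg_ext => -[k h []]; rewrite /e /=.
have e_inj : injective e.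
  by move=> a b ab; apply: sepA => k h hh; have := congr1 (@^~ (Point hh)) ab.
have sU : subuniverse (range e).
  case: e_hom => e1 e2 e3 e4 e5 e6 e7 e8 e9.
  split=> [_ _ [a _ <-] [b _ <-]|_ _ [a _ <-] [b _ <-]|_ _ [a _ <-] [b _ <-]
    |_ _ [a _ <-] [b _ <-]|_ [a _ <-]|||i|i];
    rewrite -?e1 -?e2 -?e3 -?e4 -?e5 -?e6 -?e7 -?e8 -?e9; exact: imageT.
pose f (x : subalg sU) : A := sval (cid2 (svalP x)).
have eK x : e (f x) = sval x by rewrite /f; case: cid2.
exists (subalg sU); split.
  exists (prod_alg G), (range e), sU; split=> //.
  by exists (point A), G; split=> // p; exists (psort p).
exists f; split.
  case: e_hom => e1 e2 e3 e4 e5 e6 e7 e8 e9.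
  by split=> *; apply: e_inj; rewrite ?eK ?e1 ?e2 ?e3 ?e4 ?e5 ?e6 ?e7 ?e8 ?e9 ?eK.
have Ue a : range e (e a) by exists a.
exists (fun a => exist _ (e a) (Ue a)) => [x|a]; first exact/sval_inj/eK.
by apply: e_inj; rewrite eK.
Qed.

Lemma Malg_const k (x : Malg k) :
  [\/ x = ctop (Malg k), x = cbot (Malg k), exists i, x = cf (Malg k) i |
   exists i, x = ct (Malg k) i].
Proof.
move: x; apply: J_case.
- by constructor 1.
- by constructor 2.
- by constructor 3; exists ord0; rewrite cf_ord0.
- by constructor 3; exists ord_max; rewrite cf_ord_max.
- by constructor 4; exists ord0; rewrite ct_ord0.
- by constructor 4; exists ord_max; rewrite ct_ord_max.
Qed.

Lemma Jproj_onto k (x : Malg k) : exists y, Jproj k y = x.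
Proof.
case: (Malg_const x) => [->|->|[i ->]|[i ->]].
- by exists Top.
- by exists Bot.
- by exists (F i).
- by exists (T i).
Qed.

(** A subalgebra of a product of sorts is pulled back along the product of the surjections [Jproj]
    to a subalgebra of a power of J_n, of which it is a homomorphic image. *)
Lemma ISP_M_HSP_J A : ISP_M A -> HSP_J A.
Proof.
move=> [B [[C [U [sU [[I [G [GM CG]]] BU]]]] [f [f_hom [g fK gK]]]]].
have [ks /funext ksP] := choice GM; subst G C B.
pose P := prod_alg (fun _ : I => Jalg n).
pose q (x : P) : prod_alg (fun i => Malg (ks i)) := fun i => Jproj (ks i) (x i).
have q_hom : is_hom q.
  split=> *; apply: prod_alg_ext => i; have [] := Jproj_hom (ks i);
    rewrite /q => h1 h2 h3 h4 h5 h6 h7 h8 h9.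
  - exact: h1.
  - exact: h2.
  - exact: h3.
  - exact: h4.
  - exact: h5.
  - exact: h6.
  - exact: h7.
  - exact: h8.
  - exact: h9.
have sV : subuniverse (A := P) (q @^-1` U).
  have [u1 u2 u3 u4 u5 u6 u7 u8 u9] := sU.
  case: q_hom => e1 e2 e3 e4 e5 e6 e7 e8 e9.
  by split=> *; rewrite /preimage /= ?e1 ?e2 ?e3 ?e4 ?e5 ?e6 ?e7 ?e8 ?e9; auto.
exists (subalg sV); split.
  exists P, (q @^-1` U), sV; split=> //.
  by exists I, (fun _ => Jalg n).
pose r (x : subalg sV) : subalg sU := exist U (q (sval x)) (svalP x).
exists (f \o r); split; last first.
  move=> a; have [y yP] : exists y : P, q y = sval (g a).
    have /choice[y yP] i := Jproj_onto (sval (g a) i).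
    by exists y; apply: prod_alg_ext.
  have Uy : U (q y) by rewrite yP; apply: svalP.
  exists (exist (q @^-1` U) y Uy); rewrite -[RHS]gK; congr f; exact: sval_inj.
apply: is_hom_comp f_hom _.
case: q_hom => e1 e2 e3 e4 e5 e6 e7 e8 e9.
by split=> *; apply: sval_inj => /=; rewrite ?e1 ?e2 ?e3 ?e4 ?e5 ?e6 ?e7 ?e8 ?e9.
Qed.

Lemma HSP_J_ISP_M A : HSP_J A <-> ISP_M A.
Proof.
split=> [/HSP_J_separated/separated_ISP_M//|]; exact: ISP_M_HSP_J.
Qed.

End Variety.

(** * Piggyback relations *)

Lemma J_square (b : bool) (x : J b) :
  kmeet (kjoin (tjoin x Bot) (F ord_max)) (T ord0) =
  if up x then T ord0 else Bot.
Proof. by case: b x; apply: J_case => //; congr T; apply: val_inj. Qed.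

Lemma J_flip (b : bool) (x : J b) : b ->
  desig (jneg (tmeet (kjoin x (F ord0)) (F ord_max))) = ~~ up x.
Proof. by case: b x => //; apply: J_case. Qed.

Lemma desig_kjoin (b : bool) (x : J b) : b ->
  desig (kjoin x (T ord0)) = ~~ up (jneg x).
Proof. by case: b x => //; apply: J_case. Qed.

Lemma up_kjoin (b : bool) (x : J b) :
  up (jneg (kjoin x (T ord0))) = up (jneg x).
Proof. by case: b x => //; apply: J_case. Qed.

Lemma desig_up (b : bool) (x : J b) : desig x -> up x.
Proof. by case: b x => //; apply: J_case. Qed.

Lemma desig_upN (b : bool) (x : J b) : b -> desig x -> ~~ up (jneg x).
Proof. by case: b x => //; apply: J_case. Qed.

Lemma up_desig (b : bool) (x : J b) : ~~ b -> up x = desig x.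
Proof. by case: b x => //; apply: J_case. Qed.

Section Relations.
Variable n : nat.
Implicit Types j k : 'I_n.+1.

(** This is the knowledge order of M_0, with [up x] and [up (jneg x)] as its two coordinates. *)
Lemma holds_le0 (x y : M (@ord0 n)) :
  holds (r := le0 n) x y <-> (up x -> up y) /\ (up (jneg x) -> up (jneg y)).
Proof.
have -> : holds (r := le0 n) x y =
    (up x ==> up y) && (up (jneg x) ==> up (jneg y)).
  rewrite /holds /= inE; congr is_true.
  by move: x y; rewrite /M; apply: J_case; apply: J_case.
split=> [/andP[/implyP ? /implyP ?]|[h1 h2]]; first by split.
by apply/andP; split; apply/implyP.
Qed.

(** The first two conditions mean equal images in M_0; the others let f move to 0 and t to 1, but
    not back. *)
Lemma holds_lejk j k (x : M j) (y : M k) : 0 < j -> 0 < k ->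
  holds (r := lejk j k) x y <->
  [/\ up x = up y, up (jneg x) = up (jneg y), desig x -> desig y
    & desig (jneg x) -> desig (jneg y)].
Proof.
move=> j0 k0.
have -> : holds (r := lejk j k) x y = [&& up x == up y,
    up (jneg x) == up (jneg y), desig x ==> desig y
    & desig (jneg x) ==> desig (jneg y)].
  rewrite /holds /= inE /fM /tM /zeroM /oneM; congr is_true.
  move: x y; rewrite /M; case: (0 < j) j0 => // _; case: (0 < k) k0 => // _.
  by apply: J_case; apply: J_case.
split=> [/and4P[/eqP ? /eqP ? /implyP ? /implyP ?]|[-> -> h1 h2]].
  by split.
by rewrite !eqxx /=; apply/andP; split; apply/implyP.
Qed.

End Relations.

Lemma up_g n (k : 'I_n.+1) (x : Malg k) : up (g_ x : M ord0) = up x.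
Proof. by rewrite /g_ /app /= ffunE; case: x. Qed.

Lemma up_jneg_g n (k : 'I_n.+1) (x : Malg k) :
  up (jneg (g_ x : M ord0)) = up (jneg x).
Proof. by rewrite /g_ /app /= ffunE; case: x. Qed.

(** * Inclusions between characters, seen through the alter ego *)

Section Piggyback.
Variables (n : nat) (A : alg n) (X : mstruct (Mn n)).
(** For the duality, [X] is D(A) and [rho] is evaluation; for injectivity, [X] is embedded in [Y],
    [A] is E(Y), and [rho] evaluates at the image in [Y]. *)
Variables (rho : forall k, X k -> A -> Malg k) (alpha : forall k, X k -> M k).
Implicit Types j k : 'I_n.+1.

Hypothesis rho_hom : forall k (x : X k), is_hom (rho x).
Hypothesis rho_op : forall g (gG : g \in aops (Mn n)) (x : X (src g)) a,
  rho (sop gG x) a = app (rho x a).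
Hypothesis rho_rel : forall r (rR : r \in arels (Mn n))
  (x : X (rsrc r)) (y : X (rtgt r)),
  (forall a, holds (rho x a) (rho y a)) -> srel rR x y.
Hypothesis alpha_op : forall g (gG : g \in aops (Mn n)) (x : X (src g)),
  alpha (sop gG x) = app (alpha x).
Hypothesis alpha_rel : forall r (rR : r \in arels (Mn n))
  (x : X (rsrc r)) (y : X (rtgt r)),
  srel rR x y -> holds (alpha x) (alpha y).

Lemma to_sort0 k (x : X k) : exists x0 : X ord0,
  (forall a, rho x0 a = g_ (rho x a)) /\ alpha x0 = g_ (alpha x).
Proof.
case: (posnP k) => [k0|k_gt0].
  have {}k0 : k = ord0 by apply: val_inj.
  subst k; exists x; have g0 (y : Malg (@ord0 n)) : g_ y = y.
    rewrite /g_ /app /= ffunE; move: y; rewrite /= /M /fM /tM.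
    by apply: J_case => //; congr (_ _); apply: val_inj.
  by rewrite g0; split=> // a; rewrite g0.
have gG : gk k \in aops (Mn n) by apply/imsetP; exists k; rewrite ?inE.
exists (sop gG x); split=> [a|]; first exact: (rho_op gG).
exact: (alpha_op gG).
Qed.

Lemma le0_up j k (x : X j) (y : X k) :
  (forall a, up (rho x a) -> up (rho y a)) ->
  (up (alpha x) -> up (alpha y)) /\
  (up (jneg (alpha x)) -> up (jneg (alpha y))).
Proof.
move=> xy; have [x0 [x0E ax]] := to_sort0 x; have [y0 [y0E ay]] := to_sort0 y.
have l0 : le0 n \in arels (Mn n) by rewrite !inE eqxx.
have := @alpha_rel _ l0 x0 y0; rewrite holds_le0 ax ay !up_g !up_jneg_g.
apply; apply: rho_rel => a; rewrite holds_le0 x0E y0E !up_g !up_jneg_g.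
split; first exact: xy.
by have := xy (neg a); rewrite (hom_neg (rho_hom x)) (hom_neg (rho_hom y)) => h' /h'.
Qed.

Lemma lejk_desig j k (x : X j) (y : X k) : 0 < j -> j <= k ->
  (forall a, up (rho x a) = up (rho y a)) ->
  (forall a, desig (rho x a) -> desig (rho y a)) ->
  (desig (alpha x) -> desig (alpha y)) /\
  (desig (jneg (alpha x)) -> desig (jneg (alpha y))).
Proof.
move=> j0 jk upxy xy; have k0 : 0 < k by apply: leq_trans jk.
have rjk : lejk j k \in arels (Mn n).
  rewrite finset.in_setU finset.in_setU; apply/or3P.
  have [jk'|kj] := ltnP j k.
    by constructor 3; apply/imsetP; exists (j, k); rewrite ?inE ?j0.
  have <- : j = k by apply: val_inj; apply/eqP; rewrite eqn_leq jk.
  by constructor 2; apply/imsetP; exists j; rewrite ?inE.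
have := @alpha_rel _ rjk x y; rewrite holds_lejk // => h.
suff /h[] : srel rjk x y by [].
apply: rho_rel => a; rewrite holds_lejk //; split.
- exact: upxy.
- by have := upxy (neg a); rewrite (hom_neg (rho_hom x)) (hom_neg (rho_hom y)).
- exact: xy.
- by have := xy (neg a); rewrite (hom_neg (rho_hom x)) (hom_neg (rho_hom y)).
Qed.

(** Its value is [T ord0] or [Bot], and it is designated exactly where [a] is [up]; inclusions
    between [desig] filters therefore pass to [up]. *)
Definition square (a : A) : A :=
  otimes (oplus (vee a (cbot A)) (cf A ord_max)) (ct A ord0).
(** In the sorts with k > 0 it is designated exactly where [a] is not [up], which yields the
    converse inclusions. *)
Definition flip (a : A) : A :=
  neg (wedge (oplus a (cf A ord0)) (cf A ord_max)).

Lemma rho_square k (x : X k) a :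
  rho x (square a) = if up (rho x a) then T ord0 else Bot.
Proof.
rewrite /square (hom_otimes (rho_hom x)) (hom_oplus (rho_hom x)).
rewrite (hom_vee (rho_hom x)) (hom_cbot (rho_hom x)) (hom_cf (rho_hom x)).
rewrite (hom_ct (rho_hom x)) cf_ord_max ct_ord0; exact: J_square.
Qed.

Lemma desig_square k (x : X k) a : desig (rho x (square a)) = up (rho x a).
Proof. by rewrite rho_square; case: ifP. Qed.

Lemma desig_flip k (x : X k) a : 0 < k ->
  desig (rho x (flip a)) = ~~ up (rho x a).
Proof.
rewrite /flip (hom_neg (rho_hom x)) (hom_wedge (rho_hom x)).
rewrite (hom_oplus (rho_hom x)) !(hom_cf (rho_hom x)) cf_ord_max cf_ord0.
exact: J_flip.
Qed.

(* On constants the hypothesis forces k = 0 or 0 < j <= k; then x and y are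
   related by le^0 (through g_j) or by le^jk. *)
Lemma desig_desig j k (x : X j) (y : X k) :
  (forall a, desig (rho x a) -> desig (rho y a)) ->
  (desig (alpha x) -> desig (alpha y)) /\
  (desig (jneg (alpha x)) -> desig (jneg (alpha y))).
Proof.
move=> xy.
have up_xy a : up (rho x a) -> up (rho y a).
  by rewrite -!desig_square; apply: xy.
have [k_gt0|/negP k0] := pselect (0 < k); last first.
  have [h1 h2] := le0_up up_xy.
  have upE (z : M k) : desig z = up z by rewrite up_desig.
  rewrite !upE.
  by split=> [/desig_up/h1|/desig_up/h2].
have ct_y i : desig (ct (Malg k) i) = (i < k).
  by rewrite /= /oneM /tM /M; case: ifP => //; case: (0 < k) k_gt0.
(* The constant [t_n] is designated in M_0 but not in M_k with k > 0. *)
have j_gt0 : 0 < j.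
  rewrite lt0n; apply/eqP => j0; have := xy (ct A ord_max).
  rewrite (hom_ct (rho_hom x)) (hom_ct (rho_hom y)) ct_y ct_ord_max.
  rewrite -up_desig ?j0 // => /(_ isT).
  by rewrite ltnNge -ltnS ltn_ord.
(* The constant [t_{j-1}] is designated in M_j, hence in M_k, that is, j - 1 < k. *)
have jk : j <= k.
  have j1 : j.-1 < n.+1 by apply: leq_ltn_trans (leq_pred _) (ltn_ord j).
  have := xy (ct A (Ordinal j1)).
  rewrite (hom_ct (rho_hom x)) (hom_ct (rho_hom y)) ct_y /= prednK // leqnn.
  by apply; rewrite /oneM.
apply: lejk_desig => // a; apply/idP/idP; first exact: up_xy.
by apply: contraLR; rewrite -!desig_flip //; apply: xy.
Qed.

(** Disjointness is reduced to an inclusion of [up] filters, hence to [le0]. If j and k are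
    positive, one of the two inclusions must hold; if only one is positive, the inclusion is forced;
    if both are 0, the constant top refutes the hypothesis. *)
Lemma desig_Ndesig j k (x : X j) (y : X k) :
  (forall a, desig (rho x a) -> ~~ desig (jneg (rho y a))) ->
  ~~ (desig (alpha x) && desig (jneg (alpha y))) &&
  ~~ (desig (jneg (alpha x)) && desig (alpha y)).
Proof.
have from_up j' k' (x' : X j') (y' : X k') : 0 < j' ->
    (forall a, up (rho y' a) -> up (rho x' a)) ->
    ~~ (desig (alpha x') && desig (jneg (alpha y'))) &&
    ~~ (desig (jneg (alpha x')) && desig (alpha y')).
  move=> j0 /le0_up[h1 h2]; apply/andP; split; apply/negP => /andP[dx dy].
    by have := desig_upN j0 dx; rewrite (h2 (desig_up dy)).
  by have := desig_upN j0 dx; rewrite jnegK (h1 (desig_up dy)).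
have mixed j' k' (x' : X j') (y' : X k') : 0 < j' -> ~~ (0 < k') ->
    (forall a, desig (rho x' a) -> ~~ desig (jneg (rho y' a))) ->
    ~~ (desig (alpha x') && desig (jneg (alpha y'))) &&
    ~~ (desig (jneg (alpha x')) && desig (alpha y')).
  move=> j0 k0 xy; apply: from_up => // a; apply: contraLR => xa.
  have rE k0' (z : X k0') : rho z (oplus (neg a) (ct A ord0)) =
      kjoin (jneg (rho z a)) (T ord0).
    by rewrite (hom_oplus (rho_hom z)) (hom_neg (rho_hom z))
      (hom_ct (rho_hom z)) ct_ord0.
  have upE (z : M k') : desig z = up z by rewrite up_desig.
  (* At [x'] this element is designated when [a] is not [up]; at [y'], in sort 0, its negation is
     designated when [a] is [up]. *)
  have := xy (oplus (neg a) (ct A ord0)).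
  by rewrite !rE upE desig_kjoin // up_kjoin !jnegK => /(_ xa).
have swap (a b c d : bool) :
    ~~ (a && b) && ~~ (c && d) -> ~~ (d && c) && ~~ (b && a).
  by case: a b c d => [] [] [] [].
move=> xy.
have yx a : desig (rho y a) -> ~~ desig (jneg (rho x a)).
  have := xy (neg a); rewrite (hom_neg (rho_hom x)) (hom_neg (rho_hom y)) jnegK.
  exact: contraTN.
have [j0|/negP j0] := pselect (0 < j);
  have [k0|/negP k0] := pselect (0 < k).
- have [|] := pselect (forall a, up (rho y a) -> up (rho x a)).
    exact: from_up.
  move=> /existsNP[a /not_implyP[ya /negP xa]].
  have [|] := pselect (forall a, up (rho x a) -> up (rho y a)).
    by move=> /(from_up _ _ _ _ k0)/swap.
  move=> /existsNP[b /not_implyP[xb /negP yb]].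
  (* Both inclusions fail, at [a] and at [b], so this element is 1 at [x] and 0 at [y], which
     violates the hypothesis. *)
  have := xy (oplus (square b) (neg (square a))).
  rewrite (hom_oplus (rho_hom x)) (hom_oplus (rho_hom y)).
  rewrite (hom_neg (rho_hom x)) (hom_neg (rho_hom y)) !rho_square.
  by rewrite ya xb (negPf xa) (negPf yb) => /(_ isT).
- exact: mixed.
- exact/swap/(mixed _ _ y x).
- have := xy (ctop A); rewrite (hom_ctop (rho_hom x)) (hom_ctop (rho_hom y)).
  have [xE yE] : (forall z : M j, desig z = up z) /\
    (forall z : M k, desig z = up z) by split=> z; rewrite up_desig.
  by rewrite xE yE => /(_ isT).
Qed.

(** Equal characters reduce to [desig_desig], contraposed and negated for [false]; from [true] to
    [false] it is [desig_Ndesig]; from [false] to [true] the constant bottom refutes the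
    hypothesis. *)
Lemma piggyback j k s s' (x : X j) (y : X k) :
  (forall a, char s (rho x a) -> char s' (rho y a)) ->
  char s (alpha x) -> char s' (alpha y).
Proof.
case: s; case: s' => /= xy.
- by have [] := desig_desig xy.
- by have /andP[+ _] := desig_Ndesig xy; rewrite negb_and; case: desig.
- have := xy (cbot A).
  by rewrite (hom_cbot (rho_hom x)) (hom_cbot (rho_hom y)) => /(_ isT).
- have [|_ h] := @desig_desig _ _ y x; last by apply: contraNN.
  move=> a; have := xy (neg a); rewrite (hom_neg (rho_hom x)).
  by rewrite (hom_neg (rho_hom y)) !jnegK => /contraNN; rewrite !negbK; apply.
Qed.

End Piggyback.

(** * Interpolation *)

Lemma directed_cover (X : topologicalType) (I : Type) (O : I -> set X) :
  compact [set: X] -> inhabited I -> (forall i, open (O i)) ->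
  (forall i j, exists k, O i `|` O j `<=` O k) ->
  (forall x, exists i, O i x) -> exists i, forall x, O i x.
Proof.
move=> Xco [i0] Oop Odir Ocov; apply: contrapT => nO.
have FF : ProperFilter (filter_from [set: I] (fun i => ~` O i)).
  apply: filter_from_proper => [|i _]; last first.
    by apply: contrapT => nx; apply: nO; exists i => x;
      apply: contrapT => Ox; apply: nx; exists x.
  apply: filter_from_filter; first by exists i0.
  move=> i j _ _; have [k ijk] := Odir i j; exists k => // x Okx.
  by split=> Ox; apply: Okx; apply: ijk; [left|right].
have [|x [_ xcl]] := Xco _ FF; first by exists i0.
have [i Oix] := Ocov x.
have [| |y [] //] := xcl (~` O i) (O i); first by exists i.
by apply: open_nbhs_nbhs; split.
Qed.

Lemma open_discrete_preimage (X : topologicalType) (m : nat) (f : X -> J m)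
  (P : set (J m)) : continuous f -> open (f @^-1` P).
Proof. by move=> /continuousP; apply; exact: discrete_open. Qed.

Lemma finite_simultaneous (V : finType) (T : Type) (op : T -> T -> T)
    (B : T -> Prop) (Q : V -> T -> Prop) :
  (exists a, B a) -> (forall a b, B a -> B b -> B (op a b)) ->
  (forall v a b, Q v a \/ Q v b -> Q v (op a b)) ->
  (forall v, exists a, B a /\ Q v a) -> exists a, B a /\ forall v, Q v a.
Proof.
move=> [a0 Ba0] Bop Qop Qex.
suff [a [Ba Qa]] : exists a, B a /\ forall v, v \in enum V -> Q v a.
  by exists a; split=> // v; apply: Qa; rewrite mem_enum.
elim: (enum V) => [|v s [a [Ba Qa]]]; first by exists a0.
have [b [Bb Qb]] := Qex v; exists (op b a); split; first exact: Bop.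
by move=> w; rewrite inE => /orP[/eqP->|/Qa Qwa]; apply: Qop; [left|right].
Qed.

Section Interpolation.
Variables (n : nat) (A : alg n) (X : mstruct (Mn n)).
Variables (rho : forall k, X k -> A -> Malg k) (alpha : forall k, X k -> self (Mn n) k).
Implicit Types j k : 'I_n.+1.

Hypothesis X_compact : forall k, compact [set: X k].
Hypothesis rho_hom : forall k (x : X k), is_hom (rho x).
Hypothesis rho_cont : forall k a, continuous (fun x : X k => rho x a : M k).
Hypothesis rho_op : forall g (gG : g \in aops (Mn n)) (x : X (src g)) a,
  rho (sop gG x) a = app (rho x a).
Hypothesis rho_rel : forall r (rR : r \in arels (Mn n))
  (x : X (rsrc r)) (y : X (rtgt r)),
  (forall a, holds (rho x a) (rho y a)) -> srel rR x y.
Hypothesis alpha_mor : is_mor alpha.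

Let piggy := piggyback rho_hom rho_op rho_rel (mor_op alpha_mor)
  (mor_rel alpha_mor).

(** For each [y] with [char s' (alpha y)] false, [piggyback] gives an [a] whose character holds at
    [x] and fails at [y]. Meets make such [a] directed, so compactness of each sort, and then
    finiteness of the set of sorts, give one [a] for all [y]. *)
Lemma separate_point k s (x : X k) : char s (alpha x) -> exists a,
  char s (rho x a) /\ forall v : 'I_n.+1 * bool, forall y : X v.1,
    char v.2 (alpha y) || ~~ char v.2 (rho y a).
Proof.
move=> sx.
have top : char s (rho x (ct A ord0)).
  by rewrite (hom_ct (rho_hom x)) ct_ord0; case: s {sx}.
apply: (@finite_simultaneous _ _ (@wedge _ A)).
- by exists (ct A ord0).
- by move=> a b xa xb; rewrite (hom_wedge (rho_hom x)) char_tmeet xa.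
- move=> [k' s'] a b /= ab y; case ay: (char s' (alpha y)) => //=.
  rewrite (hom_wedge (rho_hom y)) char_tmeet negb_and.
  by case: ab => /(_ y); rewrite ay /= => ->; rewrite ?orbT.
move=> [k' s'] /=.
pose O (a : {a | char s (rho x a)}) := [set y : X k' |
  char s' (alpha y) || ~~ char s' (rho y (sval a))].
have [||||[a xa] Oa] := @directed_cover (X k') _ O (@X_compact k').
- by constructor; exists (ct A ord0).
- move=> [a xa]; have -> : O (exist _ a xa) =
      (@alpha k' @^-1` [set z | char s' z]) `|`
      ((fun y => rho y a) @^-1` [set z | ~~ char s' z]).
    by apply/seteqP; split=> y /= /orP.
  by apply: openU; apply: open_discrete_preimage;
    [exact: (mor_cont alpha_mor)|exact: rho_cont].
- move=> [a xa] [b xb].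
  have xab : char s (rho x (wedge a b)).
    by rewrite (hom_wedge (rho_hom x)) char_tmeet xa.
  exists (exist (fun a => is_true (char s (rho x a))) _ xab) => y.
  rewrite /O /= (hom_wedge (rho_hom y)) char_tmeet.
  by rewrite negb_and => -[] /orP[->|->]; rewrite ?orbT.
- move=> y; apply: contrapT => nO.
  have yN a : char s (rho x a) -> char s' (rho y a) && ~~ char s' (alpha y).
    move=> xa; apply: contrapT => /negP; rewrite negb_and negbK orbC => ya.
    by apply: nO; exists (exist _ a xa).
  have /andP[_ /negP] := yN _ top; apply; apply: (piggy _ sx) => a /yN.
  by case/andP.
by exists a; split=> // y; exact: Oa.
Qed.

(** Dually, joins of the elements from [separate_point] give one [a] whose characters agree
    everywhere with those of [alpha]. In M_0, reached by [to_sort0], this covers the [up] filters,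
    and [char_up_inj] applies. *)
Lemma interpolation : exists a, forall k (x : X k), rho x a = alpha x.
Proof.
pose B a := forall v : 'I_n.+1 * bool, forall y : X v.1,
  char v.2 (alpha y) || ~~ char v.2 (rho y a).
have bot : B (cf A ord0).
  move=> [k s] y /=; rewrite (hom_cf (rho_hom y)) cf_ord0.
  by apply/orP; right; rewrite /char; case: ifP.
have Bvee a b : B a -> B b -> B (vee a b).
  move=> Ba Bb v y; rewrite (hom_vee (rho_hom y)) char_tjoin negb_or.
  by have := Ba v y; have := Bb v y; case: (char _ (alpha _)) => //= -> ->.
suff [a [Ba Qa]] : exists a, B a /\ forall v : 'I_n.+1 * bool, forall x : X v.1,
    ~~ char v.2 (alpha x) || char v.2 (rho x a).
  have aE k s (x : X k) : char s (rho x a) = char s (alpha x).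
    have := Ba (k, s) x; have := Qa (k, s) x => /=.
    by case: (char s (alpha x)); case: (char s (rho x a)).
  exists a => k x.
  have [x0 [x0a x0al]] := to_sort0 rho_op (mor_op alpha_mor) x.
  apply: char_up_inj => [s||]; first exact: aE.
    by have := aE _ true x0; rewrite /char x0a x0al !desig_g.
  have := aE _ false x0; rewrite /char x0a x0al !desig_jneg_g; exact: negb_inj.
apply: (@finite_simultaneous _ _ (@vee _ A)) => //.
- by exists (cf A ord0).
- move=> [k s] a b /= ab y; case ay: (char s (alpha y)) => //=.
  rewrite (hom_vee (rho_hom y)) char_tjoin.
  by case: ab => /(_ y); rewrite ay /= => ->; rewrite ?orbT.
move=> [k s] /=.
pose O (a : {a | B a}) := [set x : X k |
  ~~ char s (alpha x) || char s (rho x (sval a))].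
have [||||[a Ba] Oa] := @directed_cover (X k) _ O (@X_compact k).
- by constructor; exists (cf A ord0).
- move=> [a Ba]; have -> : O (exist _ a Ba) =
      (@alpha k @^-1` [set z | ~~ char s z]) `|`
      ((fun x => rho x a) @^-1` [set z | char s z]).
    by apply/seteqP; split=> y /= /orP.
  by apply: openU; apply: open_discrete_preimage;
    [exact: (mor_cont alpha_mor)|exact: rho_cont].
- move=> [a Ba] [b Bb]; exists (exist B _ (Bvee a b Ba Bb)) => y.
  rewrite /O /= (hom_vee (rho_hom y)) char_tjoin.
  by move=> -[] /orP[->|->]; rewrite ?orbT.
- move=> x; have [sx|/negPf sx] := boolP (char s (alpha x)).
    have [a [xa Ba]] := separate_point sx.
    by exists (exist B a Ba); rewrite /O /= xa orbT.
  by exists (exist B _ bot); rewrite /O /= sx.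
by exists a; split=> // x; exact: Oa.
Qed.

End Interpolation.

(** * Representation of compact structures *)

Lemma continuous_pointwise (I : Type) (X Y : topologicalType)
    (f : X -> {ptws I -> Y}) :
  (forall i, continuous (fun x => f x i)) -> continuous f.
Proof.
move=> fc x; apply/cvg_sup => i.
exact: (@continuous_comp_initial {classic (I -> Y)} X Y (fun g => g i) f (fc i)).
Qed.

Lemma compact_set_type (X : topologicalType) (Z : set X) :
  compact Z -> compact [set: set_type Z].
Proof.
move=> Zco F FF _.
have [|x [Zx xcl]] := Zco (val @ F) _.
  have FT : F setT by exact: filterT.
  by apply: (filterS (F := F)) FT => z _ /=; apply: set_mem; exact: valP.
exists (exist _ x (mem_set Zx)); split=> // B N FB.
case=> _ [[O oO <-] /= Ox] ON.
have FB' : (val @ F) (val @` B) by apply: (filterS (F := F)) FB => y By; exists y.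
have Ox' : nbhs x O by exact: open_nbhs_nbhs.
have [z [[y By yz] Oz]] := xcl _ _ FB' Ox'.
by exists y; split=> //; apply: ON; rewrite /= set_valE yz.
Qed.

Lemma power_compact n (AE : alter_ego n) (I : Type) (k : 'I_n.+1) :
  compact [set: power AE I k].
Proof.
have := @tychonoff {classic I} (fun=> M k) (fun=> setT).
have -> : [set f : {classic I} -> M k | forall i, [set: M k] (f i)] = setT.
  by apply/seteqP.
move=> pow; refine (pow _) => i; apply: finite_compact; exact: finite_finset.
Qed.

(** Each homomorphism equation involves at most three coordinates, and on these a point of the
    closure agrees with some homomorphism. *)
Lemma closed_homs n (A : alg n) (k : 'I_n.+1) :
  closed [set x : {ptws A -> M k} | is_hom (B := Malg k) x].
Proof.
move=> x x_cl.
have near1 (a : A) : nbhs x [set y : {ptws A -> M k} | y a = x a].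
  have /(_ [set x a]) := @proj_continuous {classic A} (fun=> M k) a x; apply.
  by rewrite nbhs_principalE; apply/principal_filterP.
have near3 a b c : exists2 y : A -> M k, is_hom (B := Malg k) y &
    [/\ y a = x a, y b = x b & y c = x c].
  have [y [y_hom [[ya yb] yc]]] :=
    x_cl _ (filterI (filterI (near1 a) (near1 b)) (near1 c)).
  by exists y.
split.
- move=> a b; have [y yh [<- <- <-]] := near3 a b (otimes a b).
  exact: hom_otimes yh _ _.
- move=> a b; have [y yh [<- <- <-]] := near3 a b (oplus a b).
  exact: hom_oplus yh _ _.
- move=> a b; have [y yh [<- <- <-]] := near3 a b (wedge a b).
  exact: hom_wedge yh _ _.
- move=> a b; have [y yh [<- <- <-]] := near3 a b (vee a b).
  exact: hom_vee yh _ _.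
- move=> a; have [y yh [<- <- _]] := near3 a (neg a) a.
  exact: hom_neg yh _.
- have [y yh [<- _ _]] := near3 (ctop A) (ctop A) (ctop A).
  exact: hom_ctop yh.
- have [y yh [<- _ _]] := near3 (cbot A) (cbot A) (cbot A).
  exact: hom_cbot yh.
- move=> i; have [y yh [<- _ _]] := near3 (cf A i) (cf A i) (cf A i).
  exact: hom_cf yh _.
- move=> i; have [y yh [<- _ _]] := near3 (ct A i) (ct A i) (ct A i).
  exact: hom_ct yh _.
Qed.

Section Representation.
Variable n : nat.
Implicit Types k : 'I_n.+1.
Local Notation AE := (Mn n).

(** What is used of a closed substructure of a power: relations and topology are initial for the
    coordinate maps, and compactness takes the place of closedness. *)
Record coords (X : mstruct AE) (I : Type) (phi : forall k, X k -> I -> M k) :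
    Prop := Coords {
  coords_mor : forall i, is_mor (Y := self AE) (fun k x => phi k x i);
  coords_rel : forall r (rR : r \in arels AE) (x : X (rsrc r)) (y : X (rtgt r)),
    (forall i, holds (phi _ x i) (phi _ y i)) -> srel rR x y;
  coords_cont : forall (T : topologicalType) k (f : T -> X k),
    (forall i, continuous (fun t => phi k (f t) i : M k)) -> continuous f;
  coords_inj : forall k, injective (phi k);
  coords_compact : forall k, compact [set: X k] }.

Lemma IScP_coords X : IScP (AE := AE) X ->
  exists (I : Type) (phi : forall k, X k -> I -> M k), coords phi.
Proof.
move=> [I [_ [phi [Z [sZ [Zcl [psi [[psi_mor [psi' [psi'_mor psiK psi'K]]] phiE]]]]]]]].
exists I, phi; split.
- move=> i; split=> [k|g gG x|r rR x y xy].
  + have -> : (fun x => phi k x i) = (fun x => val (psi k x) i).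
      by apply/funext => x; rewrite phiE.
    move=> x; apply: (@continuous_comp _ _ _ (psi k) (fun z => val z i)).
      exact: (mor_cont psi_mor).
    apply: (@continuous_comp _ _ _ (@set_val _ _) (fun z : {ptws I -> M k} => z i)).
      exact: initial_continuous.
    exact: (@proj_continuous {classic I} (fun=> M k)).
  + by rewrite !phiE (mor_op psi_mor).
  + have := mor_rel psi_mor xy; rewrite !phiE; exact.
- move=> r rR x y xy; rewrite -(psiK _ x) -(psiK _ y).
  by apply: (mor_rel psi'_mor) => i; rewrite -!phiE.
- move=> T k f fc.
  have -> : f = psi' k \o (psi k \o f) by apply/funext => t /=; rewrite psiK.
  have c2 : continuous (psi' k) by apply: mor_cont; exact: psi'_mor.
  suff c1 : continuous (psi k \o f).
    by move=> t; apply: continuous_comp; [exact: c1|exact: c2].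
  apply: continuous_comp_initial; apply: continuous_pointwise => i.
  have -> : (fun x => (set_val \o (psi k \o f)) x i) = (fun t => phi k (f t) i).
    by apply/funext => u /=; rewrite phiE.
  exact: fc.
- move=> k x y xy; rewrite -(psiK k x) -(psiK k y); congr (psi' k _).
  by apply: val_inj; rewrite -!phiE.
- move=> k; have Zco : compact (Z k).
    apply: (@subclosed_compact _ _ setT) => //; exact: power_compact.
  have := continuous_compact _ (compact_set_type Zco).
  move=> /(_ _ (psi' k)).
  have -> : [set psi' k x | x in [set: set_type (Z k)]] = setT.
    by apply/seteqP; split=> // x _; exists (psi k x); rewrite ?psiK.
  apply; apply: continuous_subspaceT; exact: (mor_cont psi'_mor).
Qed.

Lemma D_coords (A : alg n) :
  coords (fun k (x : D AE A k) => val x : A -> M k).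
Proof.
split.
- exact: ev_mor.
- by move=> r rR x y.
- move=> T k f fc; apply: continuous_comp_initial.
  exact: continuous_pointwise.
- by move=> k; exact: val_inj.
- move=> k; apply: compact_set_type.
  apply: (@subclosed_compact _ _ setT) => //; first exact: closed_homs.
  exact: (@power_compact _ AE A k).
Qed.

End Representation.

(** * Full and strong duality *)

Lemma tjoin_absorbl (b : bool) (x y z : J b) :
  tjoin (tjoin x y) (tmeet x z) = tjoin x y.
Proof.
apply/eqP; case: b x y z => x y z;
  by elim/J_case: x; elim/J_case: y; elim/J_case: z.
Qed.

Lemma tjoin_absorbr (b : bool) (x y z : J b) :
  tjoin (tjoin y x) (tmeet z x) = tjoin y x.
Proof.
apply/eqP; case: b x y z => x y z;
  by elim/J_case: x; elim/J_case: y; elim/J_case: z.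
Qed.

Section StrongDuality.
Variable n : nat.
Implicit Types (k : 'I_n.+1) (A : alg n).
Local Notation AE := (Mn n).

Lemma interpolate_coords A (X : mstruct AE) (rho : forall k, X k -> A -> M k)
    (alpha : forall k, X k -> self AE k) :
  (forall k, compact [set: X k]) ->
  (forall k (x : X k), is_hom (B := Malg k) (rho k x)) ->
  (forall a, is_mor (Y := self AE) (fun k x => rho k x a)) ->
  (forall r (rR : r \in arels AE) (x : X (rsrc r)) (y : X (rtgt r)),
    (forall a, holds (rho _ x a) (rho _ y a)) -> srel rR x y) ->
  is_mor alpha -> exists a, forall k x, rho k x a = alpha k x.
Proof.
move=> X_co rho_hom rho_mor rho_rel alpha_mor.
apply: (@interpolation _ A X rho alpha) => //.
- by move=> k a; have := mor_cont (rho_mor a) (k := k).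
- by move=> g gG x a; have := mor_op (rho_mor a) gG x.
Qed.

Lemma inj_surj_bijective (T V : Type) (f : T -> V) :
  injective f -> (forall v, exists t, f t = v) -> bijective f.
Proof.
move=> f_inj f_onto; have [g gK] := choice f_onto.
by exists g => // t; apply: f_inj; rewrite gK.
Qed.

Lemma ev_alg_hom A : is_hom (@ev_alg n AE A).
Proof.
have h k (x : D AE A k) : is_hom (B := Malg k) (val x : A -> M k).
  by have := valP x; rewrite in_setE.
split=> *; apply: sval_inj; apply: prod_alg_ext => k; apply: prod_alg_ext => x.
- exact: hom_otimes (h k x) _ _.
- exact: hom_oplus (h k x) _ _.
- exact: hom_wedge (h k x) _ _.
- exact: hom_vee (h k x) _ _.
- exact: hom_neg (h k x) _.
- exact: hom_ctop (h k x).
- exact: hom_cbot (h k x).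
- exact: hom_cf (h k x) _.
- exact: hom_ct (h k x) _.
Qed.

Lemma ev_alg_iso A : separated A -> is_alg_iso (@ev_alg n AE A).
Proof.
move=> sepA; split; first exact: ev_alg_hom.
apply: inj_surj_bijective => [a b ab|[alpha alpha_mor]].
  apply: sepA => k h hh.
  have hD : (h : A -> M k) \in [set x : A -> M k | is_hom (B := Malg k) x].
    by rewrite in_setE.
  pose x : D AE A k := exist _ (h : A -> M k) hD.
  exact: (congr1 (fun z => sval z k x) ab).
have DA := D_coords A.
have [|||a aP] := @interpolate_coords A (D AE A)
  (fun k x => val x : A -> M k) alpha (coords_compact DA) _ _ _ alpha_mor.
- by move=> k x; have := valP x; rewrite in_setE.
- exact: ev_mor.
- exact: (coords_rel DA).
- exists a; apply: sval_inj; apply: prod_alg_ext => k; apply: prod_alg_ext => x.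
  exact: aP.
Qed.

(** * Homomorphisms from E(X) to the sorts *)

Lemma E_proj_hom (X : mstruct AE) k (x : X k) :
  is_hom (A := E X) (B := Malg k) (fun a : E X => sval a k x).
Proof. by split. Qed.

(** Otherwise each point [x] has a pair agreeing at [x] but separated by [u]. [probe_sep] normalises
    its images under [u], [op] and compactness merge the pairs into one agreeing everywhere, and [u]
    separates equal elements. *)
Lemma E_kernel (X : mstruct AE) k (u : E X -> Malg k) :
  (forall j, compact [set: X j]) -> is_hom u ->
  exists j (x : X j), forall a b : E X, sval a j x = sval b j x -> u a = u b.
Proof.
move=> X_co u_hom; apply: contrapT => nker.
pose B (p : E X * E X) := u p.1 = F ord0 /\ u p.2 = low (0 < k).
pose Q (j : 'I_n.+1) (p : E X * E X) := forall x : X j, sval p.1 j x = sval p.2 j x.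
(* Over distributive lattices the pair [op p q] generates the intersection of
   the congruences generated by p and by q. *)
pose op (p q : E X * E X) :=
  (vee p.1 q.1, vee (vee p.1 q.1) (wedge p.2 q.2)).
have lowE : exists c : E X, u c = low (0 < k).
  have [->|->|[i ->]|[i ->]] := Malg_const (low (0 < k) : Malg k).
  - by exists (ctop _); rewrite (hom_ctop u_hom).
  - by exists (cbot _); rewrite (hom_cbot u_hom).
  - by exists (cf _ i); rewrite (hom_cf u_hom).
  - by exists (ct _ i); rewrite (hom_ct u_hom).
have [c uc] := lowE.
have B0 : B (cf (E X) ord0, c) by split=> //; exact: etrans (hom_cf u_hom _) (cf_ord0 k).
have Bop p q : B p -> B q -> B (op p q).
  move=> [p1 p2] [q1 q2]; have e1 : u (op p q).1 = F ord0.
    by apply: etrans (hom_vee u_hom p.1 q.1) _; rewrite p1 q1.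
  split=> //; apply: etrans (hom_vee u_hom (op p q).1 (wedge p.2 q.2)) _.
  rewrite e1 (hom_wedge u_hom) p2 q2 /= /low /M.
  by case: (0 < k)%N; apply/eqP.
have op_eq j (x : X j) p q :
    sval p.1 j x = sval p.2 j x \/ sval q.1 j x = sval q.2 j x ->
    sval (op p q).1 j x = sval (op p q).2 j x.
  rewrite /op /= => -[->|->]; first by rewrite tjoin_absorbl.
  by rewrite tjoin_absorbr.
have [||||[a b] [[ua ub] ab]] := @finite_simultaneous _ _ op B Q.
- by exists (cf (E X) ord0, c).
- exact: Bop.
- by move=> j p q pq x; apply: op_eq; case: pq => h; [left|right]; exact: h.
- move=> j.
  pose O (p : {p | B p}) := [set x : X j |
    sval (sval p).1 j x = sval (sval p).2 j x].
  have [||||[p Bp] Op] := @directed_cover (X j) _ O (X_co j).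
  + by constructor; exists (cf (E X) ord0, c).
  + move=> [[a b] Bp]; have -> : O (exist _ (a, b) Bp) =
        \bigcup_(z in [set: M j])
          ((fun x : X j => sval a j x : M j) @^-1` [set z] `&`
           (fun x : X j => sval b j x : M j) @^-1` [set z]).
      apply/seteqP; split=> x /=.
        by move=> abx; exists (sval a j x).
      by move=> [z _ [ax bx]]; exact: etrans ax (esym bx).
    apply: bigcup_open => z _; apply: openI; apply: open_discrete_preimage.
      exact: (mor_cont (svalP a)).
    exact: (mor_cont (svalP b)).
  + move=> [p Bp] [q Bq]; exists (exist B _ (Bop p q Bp Bq)) => x.
    exact: op_eq.
  + move=> x.
    have [a [b [abx uab]]] : exists a b : E X,
        sval a j x = sval b j x /\ u a <> u b.
      apply: contrapT => nab; apply: nker; exists j, x => a b abx.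
      by apply: contrapT => uab; apply: nab; exists a, b.
    have [tau tauN tau_ab] := probe_sep uab.
    have tx : sval (tau _ a) j x = sval (tau _ b) j x.
      by rewrite !(tauN _ _ _ (E_proj_hom x)) abx.
    rewrite -!(tauN _ _ _ u_hom) in tau_ab.
    case: tau_ab => -[ta tb].
      by exists (exist B (tau _ a, tau _ b) (conj ta tb)).
    by exists (exist B (tau _ b, tau _ a) (conj ta tb)).
  by exists p; split=> // x; exact: Op.
have ab' : a = b.
  by apply: sval_inj; apply: prod_alg_ext => j; apply: prod_alg_ext => x; exact: ab.
move: ua; rewrite /= ab' ub /low /M; case: (0 < k)%N => //.
Qed.

Lemma ev_struct_onto (X : mstruct AE) k (u : E X -> Malg k) :
  (forall j, compact [set: X j]) -> is_hom u ->
  exists x : X k, forall a, u a = sval a k x.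
Proof.
move=> X_co u_hom; have [j [x ker]] := E_kernel X_co u_hom.
(* The value of [a] at [x] is named by a constant; [a] and that constant of E(X) agree at [x], so
   [u] sends [a] to the same constant of M_k. *)
have u_const (a : E X) : exists2 c : forall B : alg n, B,
    (forall (B C : alg n) (h : B -> C), is_hom h -> h (c B) = c C) &
    sval a j x = c (Malg j) /\ u a = c (Malg k).
  have aux (c : forall B : alg n, B) :
      (forall (B C : alg n) (h : B -> C), is_hom h -> h (c B) = c C) ->
      sval a j x = c (Malg j) -> u a = c (Malg k).
    move=> cN ac; rewrite -(cN _ _ _ u_hom); apply: ker.
    by rewrite ac (cN _ _ _ (E_proj_hom x)).
  have [e|e|[i e]|[i e]] := Malg_const (sval a j x : Malg j).
  - have cN (B C : alg n) (h : B -> C) (hh : is_hom h) := hom_ctop hh.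
    by exists (fun B => ctop B) => //; split=> //; exact: aux e.
  - have cN (B C : alg n) (h : B -> C) (hh : is_hom h) := hom_cbot hh.
    by exists (fun B => cbot B) => //; split=> //; exact: aux e.
  - have cN (B C : alg n) (h : B -> C) (hh : is_hom h) := hom_cf hh i.
    by exists (fun B => cf B i) => //; split=> //; exact: (aux _ cN e).
  - have cN (B C : alg n) (h : B -> C) (hh : is_hom h) := hom_ct hh i.
    by exists (fun B => ct B i) => //; split=> //; exact: (aux _ cN e).
have [k_gt0|k_eq0] : 0 < k \/ k = ord0.
  have [k0|k_gt0] := pselect (0 < k); [by left|right].
  by apply: val_inj; apply/eqP; rewrite eqn0Ngt; apply/negP.
- have kj : j = k.
    have k1 : k.-1 < n.+1 by apply: leq_ltn_trans (leq_pred _) (ltn_ord k).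
    have ctE j' (i : 'I_n.+1) : ct (Malg j') i =
      T (if i < j' then ord0 else ord_max) by rewrite /=; case: ifP.
    (* M_k distinguishes [t_{k-1}] from [t_k], so M_j must do the same, which forces j = k. *)
    have ct_sep : ct (Malg j) (Ordinal k1) <> ct (Malg j) k.
      move=> e; have : u (ct (E X) (Ordinal k1)) = u (ct (E X) k).
        by apply: ker; exact: e.
      rewrite !(hom_ct u_hom) !ctE /= prednK // leqnn ltnn /M.
      by case: (0 < k)%N k_gt0.
    apply: val_inj; move: ct_sep; rewrite !ctE /=.
    by case: (ltnP k.-1 j) => h1; case: (ltnP k j) => h2 //= _; lia.
  subst j; exists x => a; have [c cN [-> ->]] := u_const a; by [].
- subst k.
  pose rho k (y : X k) (a : E X) : Malg k := sval a k y.
  have rho_op (g : msop n) (gG : g \in aops AE) (y : X (src g)) (a : E X) :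
      rho _ (sop gG y) a = app (rho _ y a).
    exact: (mor_op (svalP a)).
  have ctop_op := mor_op (svalP (ctop (E X))).
  have [x0 [x0E _]] := to_sort0 (rho := rho) rho_op ctop_op x.
  exists x0 => a; have [c cN [ax ->]] := u_const a.
  by have -> : sval a ord0 x0 = g_ (sval a j x); [exact: x0E|rewrite ax cN //; exact: gk_hom].
Qed.

Lemma ev_struct_iso (X : mstruct AE) : IScP X -> is_iso (@ev_struct n AE X).
Proof.
move=> /IScP_coords[I [phi cX]].
have dX := D_coords (E X).
have ev_mor : is_mor (@ev_struct n AE X).
  split=> [k|g gG x|r rR x y xy].
  - apply: (coords_cont dX) => a; exact: (mor_cont (svalP a)).
  - apply: val_inj; apply/funext => a; exact: (mor_op (svalP a)).
  - apply: (coords_rel dX) => a; exact: (mor_rel (svalP a)).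
(* The coordinate maps are elements of E(X), so evaluation is injective, and relations and
   continuity carry back from DE(X) to [X]. *)
pose c i : E X := exist _ _ (coords_mor cX i).
have ev_inj k : injective (@ev_struct n AE X k).
  move=> x y xy; apply: (coords_inj cX); apply/funext => i.
  exact: (congr1 (fun z => val z (c i)) xy).
have ev_onto k (v : D AE (E X) k) : exists x, ev_struct x = v.
  have v_hom : is_hom (B := Malg k) (val v : E X -> M k).
    by have := valP v; rewrite in_setE.
  have [x xP] := ev_struct_onto (coords_compact cX) v_hom.
  by exists x; apply: val_inj; apply/funext => a; rewrite xP.
pose psi k (v : D AE (E X) k) : X k := sval (cid (ev_onto k v)).
have psiK k : cancel (psi k) (@ev_struct n AE X k).
  by move=> v; rewrite /psi; case: cid.
split=> //; exists psi; split=> [|k x|]; last exact: psiK; last first.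
  exact/ev_inj/psiK.
have phi_psi k v i : phi k (psi k v) i = val v (c i).
  exact: (congr1 (fun z => val z (c i)) (psiK k v)).
split=> [k|g gG x|r rR x y xy].
- apply: (coords_cont cX) => i.
  have -> : (fun t => phi k (psi k t) i) = (fun v => val v (c i)).
    by apply/funext => v; exact: phi_psi.
  exact: (mor_cont (Defs.ev_mor AE (c i))).
- by apply: ev_inj; rewrite psiK (mor_op ev_mor) psiK.
- apply: (coords_rel cX) => i; rewrite !phi_psi; exact: xy.
Qed.

(** Interpolating [alpha] by elements of E(Y), evaluated on the image of [X], gives an element of
    E(Y), which is itself the extension. *)
Lemma Mn_injective : injective_in_IScP AE.
Proof.
move=> X Y phi alpha /IScP_coords[I [fX cX]] /IScP_coords[I' [fY cY]].
move=> [Z [sZ [_ [psi [[psi_mor [psi' [psi'_mor psiK _]]] phiE]]]]] alpha_mor.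
have phi_mor : is_mor phi.
  split=> [k|g gG x|r rR x y xy].
  - have -> : phi k = set_val \o psi k by apply/funext => x; rewrite phiE.
    move=> x; apply: continuous_comp; first exact: (mor_cont psi_mor).
    exact: initial_continuous.
  - by rewrite !phiE (mor_op psi_mor).
  - rewrite !phiE; exact: (mor_rel psi_mor).
pose rho k (x : X k) (b : E Y) : M k := sval b k (phi k x).
have rho_mor b : is_mor (Y := self AE) (fun k x => rho k x b).
  have [bc bo br] := svalP b; split=> [k|g gG x|r rR x y xy].
  - move=> x; apply: continuous_comp; first exact: (mor_cont phi_mor).
    exact: bc.
  - by rewrite /rho (mor_op phi_mor) bo.
  - by apply: br; exact: (mor_rel phi_mor).
have [||||b bP] := @interpolate_coords (E Y) X rho alpha (coords_compact cX).
- by move=> k x; exact: E_proj_hom.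
- exact: rho_mor.
- move=> r rR x y xy; rewrite -(psiK _ x) -(psiK _ y).
  apply: (mor_rel psi'_mor); rewrite /= -!phiE.
  apply: (coords_rel cY) => i.
  exact: (xy (exist _ _ (coords_mor cY i))).
- exact: alpha_mor.
by exists (sval b); split; [exact: svalP|exact: bP].
Qed.

Lemma Mn_strong_duality : yields_strong_duality AE (@HSP_J n).
Proof.
split; last exact: Mn_injective; split; last exact: ev_struct_iso.
by move=> A /HSP_J_separated; exact: ev_alg_iso.
Qed.

End StrongDuality.

(** * Counting the relations *)

Section Count.
Variable n : nat.
Implicit Types j k : 'I_n.+1.

(** No two members of S_(n) and graphs of G_(n) connect the same ordered pair of sorts, so this pair
    serves as an index. *)
Definition rel_of (jk : 'I_n.+1 * 'I_n.+1) : msrel n :=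
  if (jk.2 : nat) == 0%N then
    if (jk.1 : nat) == 0%N then le0 n else graph (gk jk.1)
  else lejk jk.1 jk.2.

Definition rel_index : {set 'I_n.+1 * 'I_n.+1} :=
  [set jk : 'I_n.+1 * 'I_n.+1 |
    ((jk.2 : nat) == 0%N) || (0 < jk.1 <= jk.2)]%SET.

Lemma tag_rel_of jk : tag (rel_of jk) = jk.
Proof.
case: jk => j k; rewrite /rel_of /=; case: eqP => // k0.
have {}k0 : k = ord0 by apply: val_inj.
rewrite k0; case: eqP => // j0.
by congr (_, _); apply: val_inj.
Qed.

Lemma relationsE : (Sn n :|: [set graph g | g in Gn n] = rel_of @: rel_index)%SET.
Proof.
apply/setP => r; apply/idP/imsetP => [|[[j k]]].
- rewrite !finset.in_setU finset.in_set1 => /orP[/or3P[/eqP->|/imsetP[k]|/imsetP[[j k]]]|].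
  + by exists (ord0, ord0); rewrite ?inE.
  + rewrite inE => k0 ->; exists (k, k); rewrite ?inE /= ?k0 ?leqnn ?orbT //.
    by rewrite /rel_of /= -[_ == _](negbK) -lt0n k0.
  + rewrite inE /= => /andP[j0 jk] ->; exists (j, k).
      by rewrite inE /= j0 (ltnW jk) orbT.
    by rewrite /rel_of /= gtn_eqF // (leq_trans _ jk).
  + move=> /imsetP[g /imsetP[k]]; rewrite inE => k0 -> ->.
    by exists (k, ord0); rewrite ?inE // /rel_of /= gtn_eqF.
- rewrite inE /rel_of /= => + ->.
  case: eqP => [_ _|k0 /= /andP[j0 jk]].
    case: eqP => [_|/eqP j0].
      by rewrite !finset.in_setU finset.in_set1 eqxx.
    rewrite finset.in_setU; apply/orP; right; apply/imsetP; exists (gk j) => //.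
    by apply/imsetP; exists j; rewrite // inE lt0n.
  rewrite !finset.in_setU; apply/orP; left; apply/or3P.
  move: jk; rewrite leq_eqVlt => /orP[/eqP/val_inj<-|jk].
    by constructor 2; apply/imsetP; exists j; rewrite ?inE.
  by constructor 3; apply/imsetP; exists (j, k); rewrite ?inE /= ?j0.
Qed.

(** Second entry 0 allows all n + 1 first entries; second entry [k.+1] allows the values from 1 to
    [k.+1]. *)
Lemma card_rel_index : #|rel_index| = (n.+1 + \sum_(k < n) k.+1)%N.
Proof.
transitivity (\sum_(k < n.+1)
    \sum_(j < n.+1 | ((k : nat) == 0%N) || (0 < j <= k)) 1)%N.
  rewrite -sum1_card (exchange_big_dep xpredT) //= pair_big_dep /=.
  by apply: eq_bigl => -[j k]; rewrite inE.
rewrite big_ord_recl /= sum1_card card_ord; congr addn.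
apply: eq_bigr => k _; rewrite big_mkcond big_ord_recl /= add0n -big_mkcond /=.
transitivity (\sum_(i < n | (i < k.+1)%N) 1)%N.
  by apply: eq_bigl => i; rewrite /bump /= !add1n.
by rewrite -(big_ord_widen n (fun=> 1%N)) ?ltn_ord // sum1_card card_ord.
Qed.

Lemma card_relations :
  (2 * #|Sn n :|: [set graph g | g in Gn n]%SET|)%N = (n ^ 2 + 3 * n + 2)%N.
Proof.
rewrite relationsE card_imset; last exact: (can_inj tag_rel_of).
rewrite card_rel_index.
elim: n => [|m IH]; first by rewrite big_ord0.
by rewrite big_ord_recr /=; move: IH; rewrite -!mulnn; set S := \sum_(k < m) _; lia.
Qed.

End Count.

Local Close Scope classical_set_scope.
From mathcomp Require Import all_boot all_order all_algebra.
Local Open Scope ring_scope.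

Theorem theorem5p1 (n : nat) (n_gt0 : (0 < n)%N) :
  ((forall A : alg n, HSP_J A <-> ISP_M A) /\
   yields_strong_duality (Mn n) (@HSP_J n)) /\
  #|Sn n :|: [set graph g | g in Gn n]|%:R =
    1 / 2 * (n%:R ^+ 2 + 3 * n%:R + 2) :> rat.
Proof.
split; first by split; [exact: HSP_J_ISP_M | exact: Mn_strong_duality].
have -> : (n%:R ^+ 2 + 3 * n%:R + 2 : rat) = (n ^ 2 + 3 * n + 2)%N%:R.
  by rewrite (GRing.natrD _ (_ + _) 2) GRing.natrD GRing.natrX GRing.natrM.
by rewrite -card_relations GRing.natrM GRing.mul1r GRing.mulKf.
Qed.
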